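(* Let $F$ be a field of characteristic $p\neq 0$, let $(L,[p])$ be a finite dimensional restricted Lie algebra over $F$, and let $V$ be a finite dimensional $L$-module. Suppose that the cluster $\mathrm{Cl}(V)$ is the union $C_1\cup\dots\cup C_k$ of the distinct simple clusters $C_i$. Then $V$ is a direct sum $V=V_1\oplus\dots\oplus V_k$ of $L$-submodules $V_i$ such that $\mathrm{Cl}(V_i)=C_i$ for each $i$.
   Context: Let $\bar F$ be the algebraic closure of $F$, $\bar L=\bar F\otimes_F L$, and for an $L$-module $V$ let $\bar V=\bar F\otimes_F V$ be the corresponding $\bar L$-module. The action of $x\in L$ is denoted $\rho(x)$. The $p$-operation of $L$ is written $x\mapsto x^{[p]}$; an $L$-module means a module for the Lie algebra $L$ (it need not be a restricted module). A character of $L$ is an $F$-linear map $c:L\to\bar F$. An $\bar L$-module $M$ has character $c$ if $(\rho(x)^p-\rho(x^{[p]}))v=c(x)^p v$ for all $x\in L$ and $v\in M$. Every irreducible finite dimensional $\bar L$-module has a unique character. For $\alpha\in\mathrm{Aut}(\bar F/F)$ (automorphisms of $\bar F$ fixing every element of $F$), the conjugate $c^\alpha$ of $c$ is the character $c^\alpha(x)=\alpha(c(x))$ for $x\in L$. The cluster $\mathrm{Cl}(V)$ of an $L$-module $V$ is the set of characters of the composition factors of the $\bar L$-module $\bar V$. More generally, a cluster is any finite set $C$ of $F$-linear maps $c:L\to\bar F$ which contains all conjugates of each of its elements (every $\mathrm{Cl}(V)$ is a cluster in this sense). A cluster is simple if it consists of a single conjugacy class of characters, that is, a single orbit under $\mathrm{Aut}(\bar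 F/F)$. Every cluster is a union of simple clusters. *)

(* Defs.v *)
From HB Require Import structures.
From mathcomp Require Import all_boot all_algebra.
From mathcomp Require Import classical_sets functions cardinality.

Set Implicit Arguments.
Unset Strict Implicit.
Unset Printing Implicit Defensive.

Import GRing.Theory passmx.
Local Open Scope ring_scope.
Local Open Scope classical_set_scope.

HB.mixin Record hasLieBracket (K : fieldType) L of Vector K L := {
  lieb : L -> L -> L;
  lieb_linear_l : forall z, linear (fun x => lieb x z);
  lieb_linear_r : forall z, linear (lieb z);
  liebxx : forall x, lieb x x = 0;
  lieb_jacobi : forall x y z,
    lieb x (lieb y z) + lieb y (lieb z x) + lieb z (lieb x y) = 0 }.

#[short(type="lieAlgType")]
HB.structure Definition LieAlgebra (K : fieldType) :=
  { L of hasLieBracket K L & Vector K L }.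

Section RestrictedLieAlgebra.

Variables (F : fieldType) (L : lieAlgType F).

(* Coefficient of t ^ k in ad(t x + y) ^ n (x), an element of L [t]. *)
Fixpoint ad_coef (x y : L) (n k : nat) : L :=
  match n with
  | 0 => if k is 0 then x else 0
  | n'.+1 => lieb y (ad_coef x y n' k)
             + (if k is k'.+1 then lieb x (ad_coef x y n' k') else 0)
  end.

(* Jacobson's s_i: i s_i(x, y) is the coefficient of t ^ (i - 1) in
   ad(t x + y) ^ (p - 1) (x). *)
Definition jacobson_s (p : nat) (x y : L) (i : nat) : L :=
  i%:R^-1 *: ad_coef x y p.-1 i.-1.

Definition p_operation (p : nat) (pop : L -> L) : Prop :=
  [/\ forall x y, lieb (pop x) y = iter p (lieb x) y,
      forall (a : F) x, pop (a *: x) = a ^+ p *: pop x &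
      forall x y, pop (x + y) =
        pop x + pop y + \sum_(1 <= i < p) jacobson_s p x y i].

End RestrictedLieAlgebra.

Section Modules.

Variables (K : fieldType) (L : lieAlgType K) (V : vectType K).
Implicit Types (rho : L -> 'End(V)) (U W : {vspace V}).

Definition lie_module rho : Prop :=
  linear rho /\
  forall x y v, rho (lieb x y) v = rho x (rho y v) - rho y (rho x v).

Definition submodule rho U : Prop := forall x, (rho x @: U <= U)%VS.

Definition irreducible rho : Prop :=
  (fullv : {vspace V}) <> 0%VS /\
  forall U, submodule rho U -> U = 0%VS \/ U = fullv.

End Modules.

Section Subquotients.

Variables (K : fieldType) (L : lieAlgType K) (V : vectType K).
Implicit Types (rho : L -> 'End(V)) (U W : {vspace V}).

Definition sub_action rho U (x : L) : 'End(subvs_of U) :=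
  (linfun (vsproj U) \o rho x \o linfun vsval)%VF.

(* The quotient U / W of submodules W <= U is carried by the complement U :\: W
   of W in U; the class of u in U is its component along W in this complement. *)
Definition quot_proj U W : 'Hom(V, subvs_of (U :\: W)) :=
  (linfun (vsproj (U :\: W)) \o addv_pi1 U W)%VF.

Definition quot_action rho U W (x : L) : 'End(subvs_of (U :\: W)) :=
  (quot_proj U W \o rho x \o linfun vsval)%VF.

Definition composition_series rho (m : nat) (W : nat -> {vspace V}) : Prop :=
  [/\ W 0 = 0%VS, W m = fullv,
      forall i, (i <= m)%N -> submodule rho (W i) &
      forall i, (i < m)%N ->
        (W i <= W i.+1)%VS /\ irreducible (quot_action rho (W i.+1) (W i))].

Definition composition_factor rho U W : Prop :=
  exists m S, composition_series rho m S /\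
    exists2 i, (i < m)%N & U = S i.+1 /\ W = S i.

Lemma sub_actionE rho U x (u : subvs_of U) :
  submodule rho U -> vsval (sub_action rho U x u) = rho x (vsval u).
Proof.
move=> sU; rewrite /sub_action !comp_lfunE !lfunE /= vsprojK //.
by apply: (subvP (sU x)); apply: memv_img; apply: subvsP.
Qed.

Lemma quot_projK U W (u : subvs_of (U :\: W)) : quot_proj U W (vsval u) = u.
Proof.
apply: val_inj; rewrite /quot_proj comp_lfunE lfunE /= vsprojK ?memv_pi //.
by rewrite daddv_pi_id ?capv_diff ?subvsP.
Qed.

Lemma quot_proj_ker U W u :
  u \in U -> (quot_proj U W u == 0) = (u \in W).
Proof.
move=> uU; have uUW : u \in (U + W)%VS by rewrite (subvP (addvSl U W)).
have -> : (quot_proj U W u == 0) = (addv_pi1 U W u == 0).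
  rewrite /quot_proj comp_lfunE lfunE /=.
  apply/eqP/eqP => [/(congr1 vsval)|->]; last by rewrite linear0.
  by rewrite vsprojK ?memv_pi // linear0.
have e := addv_pi1_pi2 uUW; apply/eqP/idP => [h|uW].
  by rewrite -e h add0r memv_pi2.
by apply: (addIr u); move: e; rewrite addv_pi2_id // add0r.
Qed.

Lemma quot_actionE rho U W x u :
  submodule rho U -> submodule rho W -> (W <= U)%VS -> u \in U ->
  quot_action rho U W x (quot_proj U W u) = quot_proj U W (rho x u).
Proof.
move=> sU sW sWU uU; pose v := vsval (quot_proj U W u).
have -> : quot_action rho U W x (quot_proj U W u) = quot_proj U W (rho x v).
  by rewrite /v; move: (quot_proj U W u) => w; rewrite !comp_lfunE !lfunE.
apply/eqP; rewrite -subr_eq0 -!linearB /=.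
have vU : v \in U by apply: (subvP (diffvSl U W)); apply: subvsP.
have vW : v - u \in W.
  by rewrite -(@quot_proj_ker U) ?memvB // linearB /= /v quot_projK subrr.
rewrite quot_proj_ker; last by apply: (subvP (sU x)); apply/memv_img/memvB.
by apply: (subvP (sW x)); apply: memv_img.
Qed.

Lemma lie_module_sub rho U :
  lie_module rho -> submodule rho U -> lie_module (sub_action rho U).
Proof.
move=> [rl rb] sU; split=> [a x y|x y v].
  apply/lfunP => v; apply: subvs_inj; rewrite add_lfunE scale_lfunE.
  by rewrite linearP /= !sub_actionE // rl add_lfunE scale_lfunE.
by apply: subvs_inj; rewrite linearB /= !sub_actionE.
Qed.

Lemma lie_module_quot rho U W :
  lie_module rho -> submodule rho U -> submodule rho W -> (W <= U)%VS ->
  lie_module (quot_action rho U W).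
Proof.
move=> [rl rb] sU sW sWU.
have inU (v : subvs_of (U :\: W)) : vsval v \in U.
  by apply: (subvP (diffvSl U W)); apply: subvsP.
have sUx x v : v \in U -> rho x v \in U.
  by move=> vU; apply: (subvP (sU x)); apply: memv_img.
split=> [a x y|x y v].
  apply/lfunP => v; rewrite add_lfunE scale_lfunE /= -[v]quot_projK.
  by rewrite !quot_actionE // rl add_lfunE scale_lfunE linearP.
by rewrite -[v]quot_projK !quot_actionE ?sUx // rb linearB.
Qed.

End Subquotients.

(* K (x)_F V, in coordinates on the basis vbasis {:V}. *)
Definition base_change (F K : fieldType) (iota : {rmorphism F -> K})
  (V : vectType F) : Type := 'rV[K]_(\dim {:V}).

HB.instance Definition _ (F K : fieldType) (iota : {rmorphism F -> K})
  (V : vectType F) := Vector.on (base_change iota V).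

Section BaseChange.

Variables (F K : fieldType) (iota : {rmorphism F -> K}).

(* 1 (x) v *)
Definition bc_vec (V : vectType F) (v : V) : base_change iota V :=
  map_mx iota (rVof (vbasis {:V}) v).

Lemma bc_vecP (V : vectType F) a (u v : V) :
  bc_vec (a *: u + v) = iota a *: bc_vec u + bc_vec v.
Proof. by rewrite /bc_vec linearP /= map_mxD map_mxZ. Qed.

Lemma bc_vec0 (V : vectType F) : bc_vec (0 : V) = 0.
Proof. by rewrite /bc_vec linear0 map_mx0. Qed.

Lemma bc_vecD (V : vectType F) (u v : V) :
  bc_vec (u + v) = bc_vec u + bc_vec v.
Proof. by rewrite -[u]scale1r bc_vecP rmorph1 !scale1r. Qed.

Lemma bc_vecZ (V : vectType F) a (u : V) : bc_vec (a *: u) = iota a *: bc_vec u.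
Proof. by rewrite -[a *: u]addr0 bc_vecP bc_vec0 addr0. Qed.

Lemma bc_vecB (V : vectType F) (u v : V) :
  bc_vec (u - v) = bc_vec u - bc_vec v.
Proof. by rewrite bc_vecD -scaleN1r bc_vecZ rmorphN1 scaleN1r. Qed.

Lemma bc_vec_sum (V : vectType F) (y : base_change iota V) :
  y = \sum_i y 0 i *: bc_vec (vbasis {:V})`_i.
Proof.
rewrite [LHS](row_sum_delta y); apply: eq_bigr => i _.
by rewrite /bc_vec rVofE ?vbasisP // map_delta_mx.
Qed.

Lemma bc_ind (V : vectType F) (P : base_change iota V -> Prop) :
  P 0 -> (forall a u v, P u -> P v -> P (a *: u + v)) ->
  (forall v, P (bc_vec v)) -> forall y, P y.
Proof.
move=> P0 PP Pv y; rewrite (bc_vec_sum y).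
elim/big_rec: _ => // i z _ Pz; exact: PP.
Qed.

(* id (x) f *)
Definition bc_hom (V : vectType F) (f : 'End(V)) :
    'End(base_change iota V) :=
  linfun (mulmxr (map_mx iota (mxof (vbasis {:V}) (vbasis {:V}) f)) :
            base_change iota V -> base_change iota V).

Lemma bc_homE (V : vectType F) (f : 'End(V)) v :
  bc_hom f (bc_vec v) = bc_vec (f v).
Proof.
rewrite /bc_hom lfunE /= /bc_vec -map_mxM; congr map_mx.
by rewrite (@rVof_app _ _ _ (vbasis {:V})) ?vbasisP.
Qed.

(* The K-linear extension of x |-> id (x) rho x to K (x)_F L. *)
Definition bc_action (L V : vectType F) (rho : L -> 'End(V))
    (y : base_change iota L) : 'End(base_change iota V) :=
  \sum_i y 0 i *: bc_hom (rho (vbasis {:L})`_i).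

Lemma bc_action_linear (L V : vectType F) (rho : L -> 'End(V)) :
  linear (bc_action rho).
Proof.
move=> a y z; rewrite /bc_action scaler_sumr -big_split /=.
by apply: eq_bigr => i _; rewrite !mxE scalerDl scalerA.
Qed.

Lemma bc_actionP (L V : vectType F) (rho : L -> 'End(V)) a y z v :
  bc_action rho (a *: y + z) v = a *: bc_action rho y v + bc_action rho z v.
Proof. by rewrite bc_action_linear add_lfunE scale_lfunE. Qed.

Lemma bc_actionE (L V : vectType F) (rho : L -> 'End(V)) x v :
  linear rho -> bc_action rho (bc_vec x) (bc_vec v) = bc_vec (rho x v).
Proof.
move=> rl; pose rhoL := HB.pack_for {linear L -> 'End(V)} rho
  (GRing.isLinear.Build F L 'End(V) *:%R rho rl).
rewrite /bc_action sum_lfunE.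
have -> : rho x v = \sum_i coord (vbasis {:L}) i x *: rho (vbasis {:L})`_i v.
  rewrite [in LHS](coord_vbasis (memvf x)).
  rewrite -[rho]/(rhoL : _ -> _) linear_sum sum_lfunE.
  by apply: eq_bigr => i _; rewrite !linearZ scale_lfunE.
have h : forall s : seq 'I_(\dim {:L}),
  bc_vec (\sum_(i <- s) coord (vbasis {:L}) i x *: rho (vbasis {:L})`_i v) =
  \sum_(i <- s) iota (coord (vbasis {:L}) i x) *: bc_vec (rho (vbasis {:L})`_i v).
  by elim=> [|i s IH]; rewrite ?big_nil ?bc_vec0 // !big_cons bc_vecP IH.
rewrite h; apply: eq_bigr => i _.
by rewrite scale_lfunE bc_homE /bc_vec !mxE.
Qed.

End BaseChange.

Section BaseChangeLie.

Variables (F K : fieldType) (iota : {rmorphism F -> K}) (L : lieAlgType F).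
Implicit Types x y z : base_change iota L.

Definition lie_ad (x : L) : 'End(L) := linfun (lieb x).

Lemma lie_adE (x y : L) : lie_ad x y = lieb x y.
Proof.
pose f := HB.pack_for {linear L -> L} (lieb x)
  (GRing.isLinear.Build F L L *:%R (lieb x) (lieb_linear_r x)).
by rewrite /lie_ad -[lieb x]/(f : _ -> _) lfunE.
Qed.

Lemma lie_ad_linear : linear lie_ad.
Proof.
move=> a x y; apply/lfunP => z.
by rewrite add_lfunE scale_lfunE !lie_adE lieb_linear_l.
Qed.

Definition bc_lieb (x y : base_change iota L) : base_change iota L :=
  bc_action lie_ad x y.

Lemma bc_liebE (x y : L) :
  bc_lieb (bc_vec iota x) (bc_vec iota y) = bc_vec iota (lieb x y).
Proof. by rewrite /bc_lieb bc_actionE ?lie_adE //; apply: lie_ad_linear. Qed.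

Lemma bc_lieb_linear_l z : linear (fun x => bc_lieb x z).
Proof. by move=> a x y; rewrite /bc_lieb bc_actionP. Qed.

Lemma bc_lieb_linear_r z : linear (bc_lieb z).
Proof. by move=> a x y; rewrite /bc_lieb linearP. Qed.

Let bclDl a x y z : bc_lieb (a *: x + y) z = a *: bc_lieb x z + bc_lieb y z.
Proof. exact: bc_lieb_linear_l. Qed.

Let bclDr a x y z : bc_lieb z (a *: x + y) = a *: bc_lieb z x + bc_lieb z y.
Proof. exact: bc_lieb_linear_r. Qed.

Let bcl0l z : bc_lieb 0 z = 0.
Proof. by have := bclDl (-1) 0 0 z; rewrite scaler0 add0r scaleN1r addNr. Qed.

Let bcl0r z : bc_lieb z 0 = 0.
Proof. by have := bclDr (-1) 0 0 z; rewrite scaler0 add0r scaleN1r addNr. Qed.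

Lemma liebC (x y : L) : lieb x y + lieb y x = 0.
Proof.
have D (u v w : L) : lieb (u + v) w = lieb u w + lieb v w.
  by have := lieb_linear_l w 1 u v; rewrite !scale1r.
have E (u v w : L) : lieb w (u + v) = lieb w u + lieb w v.
  by have := lieb_linear_r w 1 u v; rewrite !scale1r.
by have := liebxx (x + y); rewrite D !E !liebxx add0r addr0.
Qed.

Lemma bc_liebC x y : bc_lieb x y + bc_lieb y x = 0.
Proof.
move: x; apply: bc_ind => [|a u v hu hv|x]; first by rewrite bcl0l bcl0r addr0.
  by rewrite bclDl bclDr addrACA -scalerDr hu hv scaler0 addr0.
move: y; apply: bc_ind => [|a u v hu hv|y]; first by rewrite bcl0l bcl0r addr0.
  by rewrite bclDl bclDr addrACA -scalerDr hu hv scaler0 addr0.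
by rewrite !bc_liebE -bc_vecD liebC bc_vec0.
Qed.

Lemma bc_liebxx x : bc_lieb x x = 0.
Proof.
move: x; apply: bc_ind => [|a u v hu hv|x]; first by rewrite bcl0l.
  rewrite bclDl !bclDr hu hv scaler0 add0r addr0 -scalerDr.
  by rewrite bc_liebC scaler0.
by rewrite bc_liebE liebxx bc_vec0.
Qed.

Lemma bc_lieb_jacobi x y z :
  bc_lieb x (bc_lieb y z) + bc_lieb y (bc_lieb z x)
  + bc_lieb z (bc_lieb x y) = 0.
Proof.
have step (a : K) (u1 u2 u3 v1 v2 v3 : base_change iota L) :
    u1 + u2 + u3 = 0 -> v1 + v2 + v3 = 0 ->
    (a *: u1 + v1) + (a *: u2 + v2) + (a *: u3 + v3) = 0.
  move=> hu hv; rewrite [X in X + _]addrACA [LHS]addrACA -!scalerDr hu hv.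
  by rewrite scaler0 addr0.
move: x; apply: bc_ind => [|a u v hu hv|x].
- by rewrite !(bcl0l, bcl0r) !addr0.
- by rewrite !(bclDl, bclDr); apply: step.
move: y; apply: bc_ind => [|a u v hu hv|y].
- by rewrite !(bcl0l, bcl0r) !addr0.
- by rewrite !(bclDl, bclDr); apply: step.
move: z; apply: bc_ind => [|a u v hu hv|z].
- by rewrite !(bcl0l, bcl0r) !addr0.
- by rewrite !(bclDl, bclDr); apply: step.
by rewrite !bc_liebE -!bc_vecD lieb_jacobi bc_vec0.
Qed.

HB.instance Definition _ := hasLieBracket.Build K (base_change iota L)
  bc_lieb_linear_l bc_lieb_linear_r bc_liebxx bc_lieb_jacobi.

Lemma lie_module_bc (V : vectType F) (rho : L -> 'End(V)) :
  lie_module rho ->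
  lie_module (bc_action rho : base_change iota L -> 'End(base_change iota V)).
Proof.
move=> [rl rb]; split; first exact: bc_action_linear.
have aDl := @bc_actionP _ _ iota _ _ rho.
have aDr a y u v : bc_action rho y (a *: u + v) =
  a *: bc_action rho y u + bc_action rho y v :> base_change iota V.
  by rewrite linearP.
have a0l v : bc_action rho 0 v = 0 :> base_change iota V.
  by have := aDl (-1) 0 0 v; rewrite scaler0 add0r scaleN1r addNr.
have a0r y : bc_action rho y 0 = 0 :> base_change iota V by rewrite linear0.
have step (a : K) (u1 u2 u3 v1 v2 v3 : base_change iota V) :
    u1 = u2 - u3 -> v1 = v2 - v3 ->
    a *: u1 + v1 = (a *: u2 + v2) - (a *: u3 + v3).
  by move=> -> ->; rewrite scalerBr opprD addrACA.
move=> x y v; rewrite -[lieb x y]/(bc_lieb x y); move: x.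
apply: bc_ind => [|a x x' hx hx'|x].
- by rewrite bcl0l !a0l linear0 subr0.
- by rewrite bclDl !aDl aDr; apply: step.
move: y; apply: bc_ind => [|a y y' hy hy'|y].
- by rewrite bcl0r !a0l linear0 subr0.
- by rewrite bclDr !aDl aDr; apply: step.
move: v; apply: bc_ind => [|a v v' hv hv'|v].
- by rewrite !a0r subr0.
- by rewrite !aDr; apply: step.
by rewrite bc_liebE !bc_actionE // rb bc_vecB.
Qed.

End BaseChangeLie.

Section Clusters.

Variables (F : fieldType) (p : nat) (Fbar : fieldType).
Variable iota : {rmorphism F -> Fbar}.
Variables (L : lieAlgType F) (pop : L -> L).

Definition is_char (c : L -> Fbar) : Prop :=
  forall (a : F) x y, c (a *: x + y) = iota a * c x + c y.

Definition has_char (M : vectType Fbar)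
    (sigma : base_change iota L -> 'End(M)) (c : L -> Fbar) : Prop :=
  forall x v,
    iter p (sigma (bc_vec iota x)) v - sigma (bc_vec iota (pop x)) v
    = c x ^+ p *: v.

Definition Cl (V : vectType F) (rho : L -> 'End(V)) : set (L -> Fbar) :=
  [set c | is_char c /\
     exists U W, composition_factor (bc_action rho) U W /\
                 has_char (quot_action (bc_action rho) U W) c].

Definition is_Aut (alpha : {rmorphism Fbar -> Fbar}) : Prop :=
  bijective alpha /\ forall a : F, alpha (iota a) = iota a.

Definition conj_class (c : L -> Fbar) : set (L -> Fbar) :=
  [set d | exists2 alpha : {rmorphism Fbar -> Fbar},
             is_Aut alpha & d = (fun x => alpha (c x))].

Definition is_cluster (C : set (L -> Fbar)) : Prop :=
  [/\ finite_set C, C `<=` is_char & forall c, C c -> conj_class c `<=` C].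

Definition simple_cluster (C : set (L -> Fbar)) : Prop :=
  is_cluster C /\ exists2 c, C c & C = conj_class c.

End Clusters.

(* Main.v *)
Require Import Defs.
From HB Require Import structures.
From mathcomp Require Import all_boot all_algebra.
From mathcomp Require Import boolp classical_sets functions cardinality.

(* The operators psi(x) = rho(x)^p - rho(x^[p]) commute with the action of L,
   and x |-> psi(x) is p-semilinear by Jacobson's formula.  The characters in
   Cl(V) are the maps c such that psi(x) = c(x)^p for all x on some nonzero
   submodule of the base change of V.  On an indecomposable direct summand every
   L-endomorphism is nilpotent or invertible (Fitting), so the eigenvalues of
   L-endomorphisms at two such submodules correspond under an isomorphism of
   subrings of Fbar over F; extending it to an automorphism of Fbar shows that
   the characters of an indecomposable summand are all conjugate.  It remains to
   write V as a sum of indecomposables and to group the summands by class. *)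

Set Implicit Arguments.
Unset Strict Implicit.
Unset Printing Implicit Defensive.

Import GRing.Theory passmx.
Local Open Scope ring_scope.

(** * Commutators in characteristic p *)

(** The correspondence of eigenvalues is single-valued for this reason. Let [e] be the projection to
    an indecomposable summand. If an L-endomorphism [S] has eigenvalue 0 at one weight vector, then
    [e S e] is not invertible on the summand, hence nilpotent, and the eigenvalue of [S] at the
    other weight vector is 0 as well. Plain Galois descent would not suffice, because [F] need not
    be perfect. Extending F-homomorphisms to [Fbar] requires no separability, and the return from
    c(x)^p to c(x) is the injectivity of the Frobenius map. Direct summands are carried by
    idempotent L-endomorphisms of the fixed space [V]: sums, composites and base change apply to
    them directly, and subspaces reappear only in the final statement. *)

Section Commutator.

Variable R : nzRingType.
Implicit Types (x y : R) (q : {poly R}).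

Definition commr x y := x * y - y * x.

Lemma commrBl x y z : commr (x - y) z = commr x z - commr y z.
Proof.
by rewrite /commr mulrBl mulrBr !opprB addrACA [RHS]addrACA [- _ + _]addrC.
Qed.

(** Binomial expansion: [commr x] is the difference of left and right multiplication by [x], and
    these two operators commute. *)
Lemma iter_commr n x y :
  iter n (commr x) y =
  \sum_(i < n.+1) (-1) ^+ i * (x ^+ (n - i) * y * x ^+ i) *+ 'C(n, i).
Proof.
elim: n => [|n IHn]; first by rewrite big_ord1 /= !(mul1r, mulr1).
have signCA i u v : u * ((-1) ^+ i * v) = (-1) ^+ i * (u * v).
  by rewrite !mulrA -commr_sign.
rewrite iterS {}IHn /commr mulr_sumr mulr_suml.
rewrite big_ord_recl [X in _ - X]big_ord_recr [RHS]big_ord_recl /=.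
rewrite [X in _ = _ + X]big_ord_recr /=.
rewrite !bin0 !subn0 !binn !subnn !expr0 !mulr1n !mul1r !mulr1.
rewrite mulrA -exprS -!addrA; congr (_ + _).
rewrite opprD addrA; congr (_ + _); last first.
  by rewrite -[in RHS](mulN1r 1) [in RHS]exprS mulr1 mulN1r mulNr mulrA exprSr !mulrA.
rewrite -sumrB; apply: eq_bigr => i _.
rewrite /bump /= !add1n subSS binS mulrnDr mulrnAl mulrnAr signCA; congr (_ + _).
  by rewrite 2!(mulrA x) -exprS subnSK.
by rewrite exprS mulN1r mulNr mulNrn -!mulrA exprSr.
Qed.

Variable p : nat.
Hypothesis charRp : p \in [pchar R].

Let p_prime : prime p := pcharf_prime charRp.

Lemma pchar_bin_eq0 i : (0 < i < p)%N -> 'C(p, i)%:R = 0 :> R.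
Proof.
by move=> ip; apply/eqP; rewrite -(dvdn_pcharf charRp) prime_dvd_bin.
Qed.

Lemma iter_commr_pchar x y : iter p (commr x) y = commr (x ^+ p) y.
Proof.
rewrite iter_commr; case: p p_prime pchar_bin_eq0 charRp => // n _ binp cRp.
rewrite big_ord_recl big_ord_recr big1 /= => [|i _].
  rewrite bin0 binn subn0 subnn !mulr1n !mulr1 !mul1r add0r /commr.
  have /(_ 1) := pFrobenius_autN cRp; rewrite !pFrobenius_autE => ->.
  by rewrite expr1n mulN1r.
by rewrite -mulr_natr binp ?mulr0 // /bump /= add1n ltnS ltn_ord.
Qed.

(** Pascal's rule and the vanishing of C(p, i+1) give C(p-1, i+1) = - C(p-1, i), so the binomials
    C(p-1, i) are the signs (-1)^i. *)
Lemma pchar_bin_pred i : (i < p)%N -> 'C(p.-1, i)%:R * (-1) ^+ i = 1 :> R.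
Proof.
elim: i => [|i IHi] ip; first by rewrite bin0 mulr1.
have := pchar_bin_eq0 (_ : 0 < i.+1 < p)%N; rewrite ip => /(_ isT).
rewrite -{1}(prednK (prime_gt0 p_prime)) binS natrD => /eqP.
rewrite addr_eq0 => /eqP ->.
by rewrite exprS mulN1r mulrNN IHi // ltnW.
Qed.

(** The signs of the expansion cancel those of C(p-1, i). The remaining sum has the shape of the
    derivative of a p-th power, as in [deriv_exp_sum]. *)
Lemma iter_commr_pred_pchar x y :
  iter p.-1 (commr x) y = \sum_(i < p) x ^+ (p.-1 - i) * y * x ^+ i.
Proof.
rewrite iter_commr prednK ?prime_gt0 //; apply: eq_bigr => i _.
by rewrite -mulr_natl mulrA pchar_bin_pred ?mul1r.
Qed.

End Commutator.

(** The coefficients need not commute, so the derivative of [q] has to keep its place among the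
    factors. *)
Lemma deriv_exp_sum (R : nzRingType) (q : {poly R}) n :
  (q ^+ n)^`() = \sum_(i < n) q ^+ (n.-1 - i) * q^`() * q ^+ i.
Proof.
elim: n => [|n IHn]; first by rewrite big_ord0 expr0 derivC.
rewrite exprS derivM {}IHn big_ord_recr /= subnn expr0 mul1r addrC.
congr (_ + _); rewrite mulr_sumr; apply: eq_bigr => -[i /= lin] _.
by rewrite !mulrA -exprS; case: n lin => // n; rewrite ltnS => /subSn->.
Qed.

(** * Jacobson's formula for p-th powers in an associative ring *)

Section LieHomomorphism.

Variables (F : fieldType) (L : lieAlgType F) (R : nzRingType).
Variable f : {additive L -> R}.
Hypothesis f_lie : forall x y, f (lieb x y) = commr (f x) (f y).

(** Since ['X] is central, ad(xX + y) = X ad(x) + ad(y); reading off coefficients gives the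
    recursion of [ad_coef]. *)
Lemma coef_iter_commr x y n k :
  (iter n (commr ((f x)%:P * 'X + (f y)%:P)) (f x)%:P)`_k
  = f (ad_coef x y n k).
Proof.
elim: n k => [|n IHn] k; first by rewrite coefC; case: k => //=; rewrite raddf0.
rewrite iterS; move: (iter n _ _) IHn => A IHn.
have -> : commr ((f x)%:P * 'X + (f y)%:P) A =
    commr (f y)%:P A + commr (f x)%:P A * 'X.
  rewrite /commr mulrDl mulrDr mulrBl -!mulrA (commr_polyX A).
  by rewrite opprD addrACA [LHS]addrC.
rewrite coefD coefMX !coefB !coefCM !coefMC !IHn /= raddfD f_lie; congr (_ + _).
by case: k => [|k] /=; rewrite ?raddf0 // f_lie coefB coefCM coefMC !IHn.
Qed.

Variable p : nat.
Hypothesis charRp : p \in [pchar R].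

Let p_prime : prime p := pcharf_prime charRp.

(* Comparing coefficients in the derivative of (x t + y)^p, which is
   ad(x t + y)^(p - 1) (x). *)
Lemma exprD_jacobson x y :
  exists2 s : nat -> R,
    (f x + f y) ^+ p = f x ^+ p + f y ^+ p + \sum_(1 <= i < p) s i &
    forall i, (0 < i)%N -> s i *+ i = f (ad_coef x y p.-1 i.-1).
Proof.
pose q : {poly R} := (f x)%:P * 'X + (f y)%:P.
have charPp : p \in [pchar {poly R}] := rmorph_pchar polyC charRp.
(* Evaluating [q ^+ p] at 1 sums its coefficients and gives the left-hand side; those of degree 0
   and p are the two pure powers, the others are the s_i. *)
exists (fun i => (q ^+ p)`_i); last first.
  move=> [//|i] _ /=; rewrite -coef_deriv deriv_exp_sum -coef_iter_commr.
  rewrite iter_commr_pred_pchar //; congr (polyseq _)`_i; apply: eq_bigr => j _.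
  by rewrite derivD derivM !derivC derivX mul0r add0r mulr1 addr0.
have coef_top n : (size (q ^+ n) <= n.+1)%N /\ (q ^+ n)`_n = f x ^+ n.
  elim: n => [|n [szn topn]]; first by rewrite !expr0 size_polyC oner_neq0 coefC.
  rewrite !exprS mulrDl -mulrA -commr_polyX mulrA; split.
    rewrite (leq_trans (size_polyD _ _)) // geq_max.
    rewrite (leq_trans (size_polyMleq _ _)); last first.
      rewrite size_polyX addn2 /= ltnS (leq_trans (size_polyMleq _ _)) //.
      by rewrite (leq_trans _ szn) // -subn1 leq_subLR leq_add2r size_polyC_leq1.
    rewrite (leq_trans (size_polyMleq _ _)) // -subn1 leq_subLR.
    by rewrite leq_add ?size_polyC_leq1 // (leq_trans szn).
  rewrite coefD coefMX /= !coefCM topn nth_default ?mulr0 ?addr0 //.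
have qE : (q ^+ p).[1] = (f x + f y) ^+ p.
  rewrite horner_exp_comm; last by rewrite /comm_poly mul1r mulr1.
  by rewrite hornerD hornerCM hornerX hornerC mulr1.
have q0 : (q ^+ p)`_0 = f y ^+ p.
  rewrite -horner_coef0 horner_exp_comm; last by rewrite /comm_poly mul0r mulr0.
  by rewrite hornerD hornerCM hornerX hornerC mulr0 add0r.
have [szq topq] := coef_top p.
rewrite -qE (horner_coef_wide _ szq) (eq_bigr (fun i : 'I_p.+1 => (q ^+ p)`_i)).
  rewrite -(big_mkord xpredT (fun i => (q ^+ p)`_i)) big_nat_recr //=.
  rewrite big_ltn ?prime_gt0 // q0 topq.
  by rewrite addrC addrA.
by move=> i _; rewrite expr1n mulr1.
Qed.

End LieHomomorphism.

(** * Extension of homomorphisms to an algebraic closure *)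

Section Extension.

Local Open Scope classical_set_scope.

Variables (F : fieldType) (E : closedFieldType) (iota : {rmorphism F -> E}).
Hypothesis E_alg : forall z : E, algebraicOver iota z.

(* By additivity hom_graph_fun makes G single-valued, so G is the graph of an
   F-homomorphism from a subring of E to E. *)
Record hom_graph (G : set (E * E)) : Prop := HomGraph {
  hom_graphF : forall a, G (iota a, iota a);
  hom_graphB : forall u v, G u -> G v -> G (u - v);
  hom_graphM : forall u v, G u -> G v -> G (u * v);
  hom_graph_fun : forall b, G (0, b) -> b = 0 }.

Section HomGraphTheory.

Variable G : set (E * E).
Hypothesis homG : hom_graph G.

Lemma hom_graph0 : G 0.
Proof. by have := hom_graphF homG 0; rewrite rmorph0. Qed.

Lemma hom_graph1 : G 1.
Proof. by have := hom_graphF homG 1; rewrite rmorph1. Qed.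

Lemma hom_graphD u v : G u -> G v -> G (u + v).
Proof.
move=> Gu Gv; rewrite -[v]opprK -[- v]add0r.
by apply: (hom_graphB homG) => //; apply: (hom_graphB homG) => //; apply: hom_graph0.
Qed.

Lemma hom_graph_eq a b c : G (a, b) -> G (a, c) -> b = c.
Proof.
move=> Gb Gc; apply/eqP; rewrite -subr_eq0; apply/eqP.
apply: (hom_graph_fun homG); rewrite -(subrr a).
exact: (hom_graphB homG Gb Gc).
Qed.

Lemma hom_graph_horner (m : {poly F}) u :
  G u -> G ((map_poly iota m).[u.1], (map_poly iota m).[u.2]).
Proof.
move=> Gu; elim/poly_ind: m => [|m c IHm].
  by rewrite rmorph0 !horner0; apply: hom_graph0.
rewrite rmorphD rmorphM /= map_polyX map_polyC !hornerE.
apply: (@hom_graphD (_, _) (_, _)); last exact: (hom_graphF homG c).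
exact: (hom_graphM homG IHm Gu).
Qed.

(** If m(a) = 0, then G contains (m(a), m(0)), so the constant term of m vanishes. For a <> 0 a
    factor X can be cancelled and the argument repeated, until m = 0, against algebraicity of a. *)
Lemma hom_graph_inj a : G (a, 0) -> a = 0.
Proof.
move=> Ga; apply/eqP/negPn/negP => nz_a.
have [m nz_m rma] := E_alg a; case/negP: nz_m; move: rma.
elim/poly_ind: m => [//|m c IHm].
rewrite rootE rmorphD rmorphM /= map_polyX map_polyC !hornerE => /eqP mca.
have := hom_graph_horner (m * 'X + c%:P) Ga.
rewrite rmorphD rmorphM /= map_polyX map_polyC !hornerE mca.
move/(hom_graph_fun homG) => ic0; move: mca; rewrite ic0 addr0 => /eqP.
rewrite mulf_eq0 (negPf nz_a) orbF => /IHm/eqP->; rewrite mul0r add0r polyC_eq0.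
by rewrite -(fmorph_eq0 iota) ic0.
Qed.

(** A polynomial over the product ring packs a polynomial over the domain of [G] together with its
    image under [G]. *)
Definition coefs_in (Q : {poly E * E}) := forall i, G Q`_i.

Lemma coefs_inB P Q : coefs_in P -> coefs_in Q -> coefs_in (P - Q).
Proof. by move=> hP hQ i; rewrite coefB; apply: (hom_graphB homG). Qed.

Lemma coefs_inM P Q : coefs_in P -> coefs_in Q -> coefs_in (P * Q).
Proof.
move=> hP hQ i; rewrite coefM; elim/big_rec: _ => [|j x _]; first exact: hom_graph0.
by apply: hom_graphD; apply: (hom_graphM homG).
Qed.

Lemma coefs_inC u : G u -> coefs_in u%:P.
Proof. by move=> Gu i; rewrite coefC; case: ifP => // _; apply: hom_graph0. Qed.

Lemma coefs_inXn n : coefs_in 'X^n.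
Proof.
by move=> i; rewrite coefXn; case: eqP => _; [apply: hom_graph1|apply: hom_graph0].
Qed.

Lemma horner_fst (Q : {poly E * E}) u : Q.[u].1 = (map_poly fst Q).[u.1].
Proof. by rewrite (horner_map fst). Qed.

Lemma horner_snd (Q : {poly E * E}) u : Q.[u].2 = (map_poly snd Q).[u.2].
Proof. by rewrite (horner_map snd). Qed.

(* P plays the part of the minimal polynomial of z over the domain of G. *)
Lemma hom_graph_adjoin z :
  exists w G', [/\ hom_graph G', G `<=` G' & G' (z, w)].
Proof.
pose annihil n := `[< exists P : {poly E * E}, [/\ size P = n, coefs_in P,
  map_poly fst P != 0 & root (map_poly fst P) z] >].
have ex_ann : exists n, annihil n.
  have [m nz_m rmz] := E_alg z.
  pose P : {poly E * E} := \poly_(i < size m) (iota m`_i, iota m`_i).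
  have Pm : map_poly fst P = map_poly iota m.
    apply/polyP => i; rewrite !coef_map coef_poly; case: ltnP => //= mi.
    by rewrite nth_default ?rmorph0.
  exists (size P); apply/asboolP; exists P; split; rewrite ?Pm ?map_poly_eq0 //.
  move=> i; rewrite coef_poly; case: ltnP => _; last exact: hom_graph0.
  exact: hom_graphF.
case: (ex_minnP ex_ann) => n /asboolP[P [szP PG nzP rPz]] min_n.
(* Minimality of [P] kills the first components of the coefficients, and [hom_graph_fun] then kills
   the second ones. *)
have small_eq0 Q w : coefs_in Q -> (size Q < size P)%N -> Q.[(z, w)].1 = 0 -> Q = 0.
  move=> QG szQ; rewrite horner_fst /= => rQz.
  have /eqP Q10 : map_poly fst Q == 0.
    apply: contraLR szQ => nzQ; rewrite -leqNgt szP min_n //; apply/asboolP.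
    by exists Q; split => //; apply/eqP.
  apply/polyP => i; rewrite coef0.
  have Qi1 : (Q`_i).1 = 0 by rewrite -[LHS](coef_map fst) Q10 coef0.
  have := QG i; rewrite [Q`_i]surjective_pairing Qi1.
  by move/(hom_graph_fun homG) => ->.
have lP1 : (lead_coef P).1 != 0.
  apply: contraNneq nzP => l1.
  have := PG (size P).-1; rewrite -lead_coefE [lead_coef P]surjective_pairing l1.
  move/(hom_graph_fun homG) => l2.
  have /eqP : lead_coef P = 0 by rewrite [lead_coef P]surjective_pairing l1 l2.
  by rewrite lead_coef_eq0 => /eqP->; rewrite rmorph0.
(* By injectivity of [G] the image of [P] keeps its degree, which is positive, so it has a root [w]:
   the value to assign to [z]. *)
have lP2 : (lead_coef P).2 != 0.
  apply: contraNneq lP1 => l2; apply/eqP/hom_graph_inj.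
  by rewrite -l2 -surjective_pairing lead_coefE; apply: PG.
have [w rw] : exists w, root (map_poly snd P) w.
  apply/closed_rootP; rewrite size_map_poly_id0 //.
  apply: contraL rPz => /size_poly1P[c nzc Pc].
  rewrite Pc in lP1 *; rewrite map_polyC /= rootC.
  by rewrite lead_coefC in lP1.
have Pzw : P.[(z, w)] = 0.
  by rewrite [LHS]surjective_pairing horner_fst horner_snd (rootP rPz) (rootP rw).
exists w, [set u | exists2 Q, coefs_in Q & u = Q.[(z, w)]]; split.
- split.
  + move=> a; exists (iota a, iota a)%:P; last by rewrite hornerC.
    by apply: coefs_inC; apply: hom_graphF.
  + move=> _ _ [Q1 Q1G ->] [Q2 Q2G ->]; exists (Q1 - Q2); last by rewrite !hornerE.
    exact: coefs_inB.
  + move=> _ _ [Q1 Q1G ->] [Q2 Q2G ->]; exists (Q1 * Q2); last by rewrite !hornerE.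
    exact: coefs_inM.
  + move=> b [Q QG Qzw].
    have -> : b = Q.[(z, w)].2 by rewrite -Qzw.
    have {Qzw} : Q.[(z, w)].1 = 0 by rewrite -Qzw.
    have [k] := ubnP (size Q); elim: k Q QG => // k IHk Q QG szQ Qz.
    have [ltQP|lePQ] := ltnP (size Q) (size P).
      by rewrite (small_eq0 _ _ QG ltQP Qz) horner0.
    (* One step of pseudo-division by [P]: the domain of [G] is only a ring, so [Q] is multiplied by
       the leading coefficient of [P] instead of dividing. This factor is cancelled at the end by
       [lP2]. *)
    pose Q' := (lead_coef P)%:P * Q - (lead_coef Q)%:P * (P * 'X^(size Q - size P)).
    have Q'zw : Q'.[(z, w)] = lead_coef P * Q.[(z, w)].
      by rewrite hornerD hornerN !hornerM !hornerC Pzw mul0r mulr0 subr0.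
    have Q'G : coefs_in Q'.
      have lcG R : coefs_in R -> coefs_in (lead_coef R)%:P.
        by move=> RG; apply: coefs_inC; rewrite lead_coefE.
      apply: (coefs_inB (coefs_inM (lcG _ PG) QG)).
      exact: (coefs_inM (lcG _ QG) (coefs_inM PG (coefs_inXn _))).
    have P_gt0 : (0 < size P)%N.
      by rewrite size_poly_gt0; apply: contraNneq nzP => ->; rewrite rmorph0.
    have szQ' : (size Q' < k)%N.
      rewrite (leq_trans _ (szQ : (size Q <= k)%N)) //.
      rewrite -(prednK (leq_trans P_gt0 lePQ)) ltnS.
      have dQP : (size Q - size P)%N = ((size Q).-1 - (size P).-1)%N.
        by rewrite -{1}(prednK P_gt0) -{1}(prednK (leq_trans P_gt0 lePQ)) subSS.
      apply/leq_sizeP => j; rewrite leq_eqVlt => /predU1P[<-|ltj].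
        rewrite coefB !coefCM coefMXn dQP ltnNge leq_subr /= subKn; last first.
          by rewrite -!subn1 leq_sub2r.
        by rewrite -!lead_coefE mulrC subrr.
      have leQj : (size Q <= j)%N by rewrite -(prednK (leq_trans P_gt0 lePQ)).
      rewrite coefB !coefCM coefMXn nth_default // ltnNge (leq_trans _ leQj) ?leq_subr //=.
      rewrite nth_default ?mulr0 ?subr0 // leq_subRL ?(leq_trans _ leQj) ?leq_subr //.
      by rewrite subnK.
    have /(IHk _ Q'G szQ') : Q'.[(z, w)].1 = 0 by rewrite Q'zw /= Qz mulr0.
    by rewrite Q'zw /= => /eqP; rewrite mulf_eq0 (negPf lP2) => /eqP.
- by move=> u Gu; exists u%:P; rewrite ?hornerC //; apply: coefs_inC.
- by exists 'X; rewrite ?hornerX // -['X]expr1; apply: coefs_inXn.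
Qed.

End HomGraphTheory.

Lemma hom_graph_maximal G : hom_graph G ->
  exists H, [/\ hom_graph H, G `<=` H & forall z, exists w, H (z, w)].
Proof.
move=> homG.
(* Zorn is applied to the sets [A] that enlarge [G] to a graph, so that the empty chain is covered
   too: its union gives back [G]. *)
have [|A [homA maxA]] := @Zorn_bigcup _ [set A | hom_graph (G `|` A)].
  move=> X XG Xtot /=.
  have GX A : X A -> G `|` A `<=` G `|` \bigcup_(A in X) A.
    by move=> XA u [Gu|Au]; [left | right; exists A].
  have cover1 u : (G `|` \bigcup_(A in X) A) u ->
      G u \/ exists2 A, X A & (G `|` A) u.
    by case=> [|[A XA Au]]; [left | right; exists A => //; right].
  have cover u v : (G `|` \bigcup_(A in X) A) u -> (G `|` \bigcup_(A in X) A) v ->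
      exists H, [/\ hom_graph H, H `<=` G `|` \bigcup_(A in X) A, H u & H v].
    have GXs : G `<=` G `|` \bigcup_(A in X) A by left.
    move=> /cover1[Gu|[A XA Au]] /cover1[Gv|[B XB Bv]].
    - by exists G.
    - by exists (G `|` B); split; [exact: XG | exact: GX | by left | exact: Bv].
    - by exists (G `|` A); split; [exact: XG | exact: GX | exact: Au | by left].
    - have [AB|BA] := Xtot _ _ XA XB.
        exists (G `|` B); split; [exact: XG | exact: GX | | by []].
        by case: Au => [|/AB]; [left | right].
      exists (G `|` A); split; [exact: XG | exact: GX | by [] |].
      by case: Bv => [|/BA]; [left | right].
  split.
  - by move=> a; left; apply: hom_graphF.
  - by move=> u v Xu Xv; have [H [homH HX Hu Hv]] := cover u v Xu Xv;
       exact: HX (hom_graphB homH Hu Hv).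
  - by move=> u v Xu Xv; have [H [homH HX Hu Hv]] := cover u v Xu Xv;
       exact: HX (hom_graphM homH Hu Hv).
  - by move=> b Xb; have [H [homH HX Hb _]] := cover _ _ Xb Xb;
       exact: hom_graph_fun homH _ Hb.
exists (G `|` A); split => // z.
have [w [H [homH AH Hzw]]] := hom_graph_adjoin homA z.
exists w; have [HA|nHA] := pselect (H `<=` A); first by right; apply: HA.
case: (maxA H); first by split=> [u Au|//]; apply: AH; right.
by rewrite /= (_ : G `|` H = H) //; apply/setUidPr => u Gu; apply: AH; left.
Qed.

(** [alpha] maps the finite set of roots of a polynomial over [F] injectively into itself, hence
    onto itself. *)
Lemma endo_surj (alpha : {rmorphism E -> E}) :
  (forall a, alpha (iota a) = iota a) -> forall y, exists x, alpha x = y.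
Proof.
move=> alphaF y; have [m nz_m rmy] := E_alg y.
have [rs mE] := closed_field_poly_normal (map_poly iota m).
have rsP x : (x \in undup rs) = root (map_poly iota m) x.
  rewrite mE rootZ ?root_prod_XsubC ?mem_undup //.
  by rewrite lead_coef_eq0 map_poly_eq0.
have [] := @uniq_min_size _ (map alpha (undup rs)) (undup rs).
- by rewrite map_inj_uniq ?undup_uniq //; apply: fmorph_inj.
- move=> _ /mapP[x xrs ->]; rewrite rsP; move: xrs; rewrite rsP !rootE => /eqP mx.
  have <- : map_poly alpha (map_poly iota m) = map_poly iota m.
    by rewrite -map_poly_comp; apply: eq_map_poly => a /=; apply: alphaF.
  by rewrite horner_map mx rmorph0.
- by rewrite size_map.
move=> _ /(_ y); rewrite rsP rmy => /mapP[x _ ->].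
by exists x.
Qed.

Lemma extend_to_Aut G : hom_graph G ->
  exists2 alpha : {rmorphism E -> E}, is_Aut iota alpha &
    forall a b, G (a, b) -> alpha a = b.
Proof.
move=> /hom_graph_maximal[H [homH GH totH]].
have [alpha alphaH] := choice totH.
have alphaE a b : H (a, b) -> alpha a = b by apply: (hom_graph_eq homH) (alphaH a).
have alphaB : zmod_morphism alpha.
  by move=> x y; apply/alphaE/(hom_graphB homH (alphaH x) (alphaH y)).
have alphaM : monoid_morphism alpha.
  split=> [|x y]; first exact/alphaE/(hom_graph1 homH).
  exact/alphaE/(hom_graphM homH (alphaH x) (alphaH y)).
pose f := HB.pack_for {rmorphism E -> E} alpha
  (GRing.isZmodMorphism.Build E E alpha alphaB)
  (GRing.isMonoidMorphism.Build E E alpha alphaM).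
have fF a : f (iota a) = iota a by exact: alphaE (hom_graphF homH a).
exists f; last by move=> a b /GH/alphaE.
split=> //; have [g fg] := choice (endo_surj fF).
by exists g => x; [apply: (fmorph_inj f) | ]; apply: fg.
Qed.

End Extension.

(** * Powers of endomorphisms and the Fitting decomposition *)

Section LfunPower.

Variables (K : fieldType) (V : vectType K).
Implicit Types (f : 'End(V)) (U : {vspace V}).

Definition lexp n f : 'End(V) := iter n (comp_lfun f) \1%VF.

Lemma lexpE n f v : lexp n f v = iter n f v.
Proof. by elim: n => [|n IHn]; rewrite /lexp /= (id_lfunE, comp_lfunE) ?IHn. Qed.

Lemma lexpZ n a f : lexp n (a *: f) = a ^+ n *: lexp n f.
Proof.
elim: n => [|n IHn]; first by rewrite expr0 scale1r.
by rewrite /lexp !iterS -!/(lexp _ _) IHn -comp_lfunZl -comp_lfunZr scalerA -exprS.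
Qed.

Lemma lexp_commute n f g v :
  (forall u, f (g u) = g (f u)) -> lexp n f (g v) = g (lexp n f v).
Proof. by move=> fg; rewrite !lexpE; elim: n => //= n ->. Qed.

Lemma lexp_stable n f U v :
  (f @: U <= U)%VS -> v \in U -> lexp n f v \in U.
Proof.
move=> fU vU; rewrite lexpE; elim: n => //= n IHn.
by apply: (subvP fU); apply: memv_img.
Qed.

(** The exponent is the one that minimises the dimension of the image of [U] among positive powers;
    the power [g] then maps g(U) onto itself, hence injectively. Positivity of the exponent is
    needed where [f] kills a vector or moves it into a submodule. *)
Lemma fitting f U : (f @: U <= U)%VS ->
  exists n, [/\ (0 < n)%N, (U <= U :&: lker (lexp n f) + lexp n f @: U)%VS &
                (lexp n f @: U :&: lker (lexp n f) = 0)%VS].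
Proof.
move=> fU.
have exP : exists d, `[< exists n, \dim (lexp n.+1 f @: U) = d >].
  by exists (\dim (lexp 1 f @: U)); apply/asboolP; exists 0.
case: (ex_minnP exP) => d /asboolP[n dn] min_d.
exists n.+1; set g := lexp n.+1 f in dn *.
have gU v : v \in U -> g v \in U by apply: lexp_stable.
have sub_gg : (g @: (g @: U) <= g @: U)%VS.
  by apply: limgS; apply/subvP => _ /memv_imgP[u uU ->]; apply: gU.
have dim_gg : \dim (g @: (g @: U)) = \dim (g @: U).
  apply/eqP; rewrite eqn_leq dimvS //= dn; apply: min_d.
  apply/asboolP; exists (n.+1 + n)%N.
  congr (\dim _); rewrite -limg_comp; apply: eq_in_limg => v _.
  by rewrite comp_lfunE !lexpE -iterD addnS.
split=> //.
- apply/subvP => u uU.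
  have : g u \in (g @: (g @: U))%VS.
    have /eqP -> : (g @: (g @: U) == g @: U)%VS by rewrite eqEdim sub_gg dim_gg /=.
    exact: memv_img.
  case/memv_imgP => _ /memv_imgP[u' u'U ->] gu.
  rewrite -[u](subrK (g u')) memv_add ?memv_img // memv_cap memvB ?gU //=.
  by rewrite memv_ker linearB /= gu subrr.
- by apply/eqP; rewrite -dimv_eq0 -(eqn_add2r (\dim (g @: (g @: U)))) limg_ker_dim dim_gg.
Qed.

End LfunPower.

Lemma closed_eigenvector (K : closedFieldType) (V : vectType K) (f : 'End(V))
    (U : {vspace V}) :
  (f @: U <= U)%VS -> U != 0%VS ->
  exists a, exists2 u, u \in U /\ u != 0 & f u = a *: u.
Proof.
move=> fU nzU; pose g : 'End(subvs_of U) := (linfun (vsproj U) \o f \o linfun vsval)%VF.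
pose b := vbasis {:subvs_of U}; have bb : basis_of {:subvs_of U} b := vbasisP _.
pose A := mxof b b g.
have /closed_rootP[a] : size (char_poly A) != 1%N.
  by rewrite size_char_poly eqSS dimvf -[dim _]/(\dim U) dimv_eq0.
rewrite -eigenvalue_root_char => /eigenvalueP[v vA nzv].
exists a; exists (vsval (vecof b v)).
  split; first exact: subvsP.
  apply: contraNneq nzv => v0; rewrite -(vecof_eq0 bb); apply/eqP.
  exact/val_inj.
have gE w : vsval (g w) = f (vsval w).
  rewrite !comp_lfunE !lfunE /= vsprojK //.
  by apply: (subvP fU); apply: memv_img; apply: subvsP.
by rewrite -gE (@hom_vecof _ _ _ b b) // vA linearZ.
Qed.

(** * Submodules and composition series *)

Lemma submoduleP (K : fieldType) (L : lieAlgType K) (V : vectType K)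
    (rho : L -> 'End(V)) (U : {vspace V}) :
  submodule rho U <-> forall x u, u \in U -> rho x u \in U.
Proof.
split=> [sU x u uU|sU x]; first by apply: (subvP (sU x)); apply: memv_img.
by apply/subvP => _ /memv_imgP[u uU ->]; apply: sU.
Qed.

Section Submodules.

Variables (K : fieldType) (L : lieAlgType K) (V : vectType K).
Variable rho : L -> 'End(V).
Implicit Types (U W Z : {vspace V}).

Lemma submodule0 : submodule rho 0.
Proof. by move=> x; rewrite limg0. Qed.

Lemma submodulef : submodule rho fullv.
Proof. by move=> x; apply: subvf. Qed.

Lemma submodule_cap U W :
  submodule rho U -> submodule rho W -> submodule rho (U :&: W).
Proof. by move=> sU sW x; rewrite (subv_trans (limg_cap _ _ _)) // capvS. Qed.

Lemma submodule_img (f : 'End(V)) U :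
  (forall x u, u \in U -> f (rho x u) = rho x (f u)) ->
  submodule rho U -> submodule rho (f @: U).
Proof.
move=> frho /submoduleP sU; apply/submoduleP => x _ /memv_imgP[u uU ->].
by rewrite -frho // memv_img // sU.
Qed.

Lemma submodule_ker (f : 'End(V)) :
  (forall x u, f (rho x u) = rho x (f u)) -> submodule rho (lker f).
Proof.
move=> frho; apply/submoduleP => x u; rewrite !memv_ker frho => /eqP->.
by rewrite linear0.
Qed.

Definition minimal_over W U := [/\ submodule rho U, (W <= U)%VS, W <> U &
  forall Z, submodule rho Z -> (W <= Z)%VS -> (Z <= U)%VS -> Z = W \/ Z = U].

Lemma minimal_overP W U : submodule rho U -> (W <= U)%VS -> W <> U ->
  exists2 Z, minimal_over W Z & (Z <= U)%VS.
Proof.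
have [n] := ubnP (\dim U); elim: n U => // n IHn U dU sU WU nWU.
have [minU|] := pselect (minimal_over W U); first by exists U.
have [[Z [sZ WZ ZU nZW nZU]] _|noZ []] := pselect (exists Z,
    [/\ submodule rho Z, (W <= Z)%VS, (Z <= U)%VS, W <> Z & Z <> U]).
  have [] := IHn Z _ sZ WZ nZW;
    last by move=> Y minY YZ; exists Y => //; apply: subv_trans ZU.
  rewrite (leq_trans _ (dU : \dim U <= n)%N) // ltn_neqAle dimvS // andbT.
  by rewrite (dimv_leqif_eq ZU); apply/eqP.
split=> // Z sZ WZ ZU.
have [ZW|nZW] := eqVneq Z W; first by left.
have [|nZU] := eqVneq Z U; first by right.
by case: noZ; exists Z; split => //; apply/eqP; rewrite // eq_sym.
Qed.

Lemma minimal_over_irreducible W U : submodule rho W -> minimal_over W U ->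
  irreducible (quot_action rho U W).
Proof.
move=> sW [sU WU nWU minU].
have inU (v : subvs_of (U :\: W)) : vsval v \in U.
  by apply: (subvP (diffvSl U W)); apply: subvsP.
split=> [f0|Z sZ].
  apply: nWU; apply/eqP; rewrite eqEsubv WU -diffv_eq0 -dimv_eq0.
  have := dimvf (subvs_of (U :\: W)); rewrite f0 dimv0.
  by move/esym/eqP.
pose Z' := (U :&: (quot_proj U W @^-1: Z))%VS.
have Z'E u : u \in U -> (u \in Z') = (quot_proj U W u \in Z).
  by move=> uU; rewrite memv_cap uU -memv_preim.
have sZ' : submodule rho Z'.
  apply/submoduleP => x u uZ'; have /andP[uU _] : (u \in U) && true.
    by move: uZ'; rewrite memv_cap => /andP[->].
  have rU : rho x u \in U by move/submoduleP: sU; apply.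
  rewrite Z'E // -quot_actionE //; move/submoduleP: sZ; apply.
  by rewrite -Z'E.
have WZ' : (W <= Z')%VS.
  apply/subvP => w wW; have wU := subvP WU _ wW.
  rewrite Z'E //; have /eqP -> : quot_proj U W w == 0 by rewrite quot_proj_ker.
  exact: mem0v.
have [Z'W|Z'U] := minU Z' sZ' WZ' (capvSl _ _).
  left; apply/eqP; rewrite -subv0; apply/subvP => z zZ.
  have : vsval z \in Z' by rewrite Z'E // quot_projK.
  by rewrite Z'W -(@quot_proj_ker _ _ U) // quot_projK memv0.
right; apply/eqP; rewrite eqEsubv subvf andTb; apply/subvP => z _.
by rewrite -[z]quot_projK -Z'E // Z'U.
Qed.

(** Starting from an arbitrary [W] instead of 0 allows a prescribed minimal submodule to be made the
    first term of a composition series. *)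
Lemma composition_series_over W : submodule rho W -> exists m S,
  [/\ S 0 = W, S m = fullv, forall i, (i <= m)%N -> submodule rho (S i) &
   forall i, (i < m)%N ->
     (S i <= S i.+1)%VS /\ irreducible (quot_action rho (S i.+1) (S i))].
Proof.
have [n] := ubnP (dim V - \dim W); elim: n W => // n IHn W dW sW.
have [Wf|/eqP nWf] := eqVneq W fullv.
  by exists 0, (fun=> W); split.
have [U minU _] := minimal_overP submodulef (subvf W) nWf.
have [sU WU nWU _] := minU.
have ltWU : (\dim W < \dim U)%N.
  by rewrite ltn_neqAle dimvS // andbT (dimv_leqif_eq WU); apply/eqP.
have [|m [S [S0 Sm sS irrS]]] := IHn U _ sU.
  rewrite (leq_trans _ (dW : (_ <= n)%N)) // ltn_sub2l //.
  by rewrite -dimvf (leq_trans ltWU) // dimvS ?subvf.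
exists m.+1, (fun i => if i is j.+1 then S j else W); split=> // [[|i]|[|i]] //.
- exact: sS.
- by move=> _; rewrite S0; split => //; apply: minimal_over_irreducible.
- exact: irrS.
Qed.

Lemma composition_factor_minimal U : minimal_over 0 U -> composition_factor rho U 0.
Proof.
move=> minU; have [sU _ _ _] := minU.
have [m [S [S0 Sm sS irrS]]] := composition_series_over sU.
exists m.+1, (fun i => if i is j.+1 then S j else 0%VS); split; last first.
  by exists 0 => //; rewrite S0.
split=> // [[|i]|[|i]] //.
- by move=> _; apply: submodule0.
- exact: sS.
- move=> _; rewrite S0; split; first exact: sub0v.
  exact: minimal_over_irreducible submodule0 minU.
- exact: irrS.
Qed.

(* Inside a smallest submodule U not contained in W every T x - lambda x is
   nilpotent, by the Fitting decomposition; a minimal submodule of U is then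
   killed by all of them. *)
Lemma eigen_submodule (X : Type) (T : X -> 'End(V)) (lambda : X -> K) U W :
  (forall i x v, T i (rho x v) = rho x (T i v)) ->
  (forall i Z, submodule rho Z -> (T i @: Z <= Z)%VS) ->
  submodule rho U -> submodule rho W -> ~~ (U <= W)%VS ->
  (forall i u, u \in U -> T i u - lambda i *: u \in W) ->
  exists2 Z, minimal_over 0 Z & (Z <= U)%VS /\
    forall i u, u \in Z -> T i u = lambda i *: u.
Proof.
move=> T_rho T_stable sU sW; have [n] := ubnP (\dim U).
elim: n U sU => // n IHn U sU dU nUW TU.
pose N i := T i - lambda i *: \1%VF.
have NE i v : N i v = T i v - lambda i *: v.
  by rewrite !(add_lfunE, opp_lfunE, scale_lfunE, id_lfunE).
have N_rho i x v : N i (rho x v) = rho x (N i v).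
  by rewrite !NE T_rho [in RHS]linearB [in RHS]linearZ /=.
have N_stable i Z : submodule rho Z -> (N i @: Z <= Z)%VS.
  move=> sZ; apply/subvP => _ /memv_imgP[u uZ ->]; rewrite NE.
  by rewrite memvB ?memvZ // (subvP (T_stable i Z sZ)) // memv_img.
have [nilN|] := pselect (forall i, exists n, (U <= lker (lexp n (N i)))%VS).
  have n0U : 0%VS <> U by move=> U0; move: nUW; rewrite -U0 sub0v.
  have [Z minZ ZU] := minimal_overP sU (sub0v U) n0U. 
  exists Z; [by [] | split=> [//|i u uZ]]; have [sZ _ n0Z irrZ] := minZ.
  apply/eqP; rewrite -subr_eq0 -NE.
  have [NZ0|NZZ] := irrZ _ (submodule_img (fun x v _ => N_rho i x v) sZ)
    (sub0v _) (N_stable i Z sZ).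
    by rewrite -memv0 -NZ0 memv_img.
  have [k Uk] := nilN i; case: n0Z; apply/esym/eqP; rewrite -subv0.
  have <- : (lexp k (N i) @: Z = Z)%VS.
    elim: k {Uk} => [|k IHk]; first by rewrite lim1g.
    by rewrite /lexp iterS -/(lexp _ _) limg_comp IHk NZZ.
  by rewrite subv0 -lkerE (subv_trans ZU).
move=> /existsNP[i /forallNP notnil].
have [k [k_gt0 Usum _]] := fitting (N_stable i U sU).
set g := lexp k (N i) in Usum.
(* As k > 0, the first application of [N i] already lands in [W], and the others stay there. So the
   Fitting kernel in [U] is not contained in [W], and it is smaller than [U] because [N i] is not
   nilpotent. *)
have gU : (g @: U <= W)%VS.
  apply/subvP => _ /memv_imgP[u uU ->]; rewrite /g.
  case: k k_gt0 {g Usum} => // k _; rewrite lexpE iterSr -lexpE.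
  by apply: lexp_stable; [apply: N_stable | rewrite NE; apply: TU].
have sU' : submodule rho (U :&: lker g).
  apply: submodule_cap => //; apply: submodule_ker => x u.
  exact: lexp_commute.
have [] := IHn _ sU'.
- rewrite (leq_trans _ (dU : _ <= n)%N) // ltn_neqAle dimvS ?capvSl // andbT.
  rewrite (dimv_leqif_eq (capvSl _ _)); apply/eqP => UU'; apply: (notnil k).
  by apply/capv_idPl.
- apply: contra nUW => U'W; apply: (subv_trans Usum).
  by rewrite subv_add U'W.
- by move=> j u; rewrite memv_cap => /andP[uU _]; apply: TU.
move=> Z minZ [ZU' TZ]; exists Z => //; split=> //.
by apply: subv_trans ZU' (capvSl _ _).
Qed.

End Submodules.

(** * The operators rho(x)^p - rho(x^[p]) *)

Lemma dim0_eq0 (K : fieldType) (V : vectType K) (u : V) : dim V = 0 -> u = 0.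
Proof.
move=> V0; apply/eqP; rewrite -memv0 (_ : 0%VS = fullv) ?memvf //.
by apply/esym/eqP; rewrite -dimv_eq0 dimvf V0.
Qed.

Definition pdefect (p : nat) (K : fieldType) (L : lieAlgType K) (pop : L -> L)
    (V : vectType K) (rho : L -> 'End(V)) (x : L) : 'End(V) :=
  lexp p (rho x) - rho (pop x).

Section PDefect.

Variables (F : fieldType) (p : nat).
Hypothesis charFp : p \in [pchar F].
Variables (L : lieAlgType F) (pop : L -> L).
Hypothesis Lp : p_operation p pop.
Variables (V : vectType F) (rho : L -> 'End(V)).
Hypothesis Vmod : lie_module rho.

Local Notation psi := (pdefect p pop rho).

Lemma lie_moduleZ a x : rho (a *: x) = a *: rho x.
Proof.
have [rl _] := Vmod; have rho0 : rho 0 = 0.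
  by have := rl (-1) 0 0; rewrite scaler0 add0r scaleN1r addNr.
by rewrite -[a *: x]addr0 rl rho0 addr0.
Qed.

Lemma lie_moduleB : zmod_morphism rho.
Proof.
have [rl _] := Vmod.
by move=> x y; rewrite addrC -scaleN1r rl scaleN1r addrC.
Qed.

Section EndRing.

Hypothesis V_gt0 : (0 < dim V)%N.

(** The results on commutators and powers need a nonzero ring, which ['End(V)] is only for V <> 0;
    the zero space is treated separately after this section. *)
Let R : nzRingType := lfun_comp_nzRingType V_gt0.

Let charRp : p \in [pchar R].
Proof.
rewrite inE (pcharf_prime charFp) /=; apply/eqP.
rewrite -[p%:R]/(\1%VF *+ p : 'End(V)).
by rewrite -scaler_nat (pcharf0 charFp) scale0r.
Qed.

Let f : {additive L -> R} :=
 HB.pack_for {additive L -> R} rho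
  (GRing.isZmodMorphism.Build L R rho lie_moduleB).

Let f_lie x y : f (lieb x y) = commr (f x) (f y).
Proof.
apply/lfunP => v; rewrite [LHS](Vmod.2).
by rewrite /commr add_lfunE opp_lfunE !comp_lfunE.
Qed.

Let lexpX n (g : R) : g ^+ n = lexp n g.
Proof. by elim: n => [|n IHn] //; rewrite exprS IHn. Qed.

(** Both terms have the same commutator with [rho y]: ad(rho x)^p is ad of (rho x)^p in
    characteristic p, and it is also ad of rho(x^[p]) by the first axiom of the p-operation. *)
Lemma pdefect_comm_pos x y : (psi x \o rho y = rho y \o psi x)%VF.
Proof.
have [adp _ _] := Lp.
suff /eqP : commr (f x ^+ p - f (pop x)) (f y) = 0 by rewrite lexpX subr_eq0 => /eqP.
rewrite commrBl -f_lie adp -(iter_commr_pchar charRp).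
suff -> n : f (iter n (lieb x) y) = iter n (commr (f x)) (f y) by rewrite subrr.
by elim: n => //= n IHn; rewrite -IHn; apply: f_lie.
Qed.

Lemma pdefectD_pos x y : psi (x + y) = psi x + psi y.
Proof.
have [_ _ popD] := Lp.
have [s fxy sE] := exprD_jacobson f_lie charRp x y.
have {}sE i : (0 < i < p)%N -> s i = f (jacobson_s p x y i).
  move=> ip; have nzi : i%:R != 0 :> F.
    case/andP: ip => i_gt0 ltip.
    by rewrite -(dvdn_pcharf charFp) gtnNdvd.
  rewrite /jacobson_s [RHS]lie_moduleZ.
  have -> : rho (ad_coef x y p.-1 i.-1) = s i *+ i.
    by apply/esym/sE; case/andP: ip.
  by rewrite -[s i *+ i]/((s i : 'End(V)) *+ i) -scaler_nat scalerA mulVf ?scale1r.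
have rhoD u v : rho (u + v) = rho u + rho v.
  by have [rl _] := Vmod; rewrite -[u]scale1r rl !scale1r.
rewrite /pdefect popD !rhoD.
have -> : lexp p (rho x + rho y) =
    lexp p (rho x) + lexp p (rho y) + rho (\sum_(1 <= i < p) jacobson_s p x y i).
  rewrite -!lexpX -[rho x + rho y]/(f x + f y) [LHS]fxy; congr (_ + _).
  rewrite -[rho _]/(f _) raddf_sum /= !big_nat; apply: eq_bigr => i ip.
  by rewrite sE.
by rewrite opprD addrACA subrr addr0 opprD addrACA.
Qed.

End EndRing.

Lemma pdefect_comm x y v : psi x (rho y v) = rho y (psi x v).
Proof.
have [V_eq0|V_gt0] := posnP (dim V); last first.
  by rewrite -!comp_lfunE pdefect_comm_pos.
by rewrite [LHS](dim0_eq0 _ V_eq0) [RHS](dim0_eq0 _ V_eq0).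
Qed.

Lemma pdefect_semilinear a x y : psi (a *: x + y) = a ^+ p *: psi x + psi y.
Proof.
have [V_eq0|V_gt0] := posnP (dim V); last first.
  rewrite pdefectD_pos //; congr (_ + _); have [_ popZ _] := Lp.
  by rewrite /pdefect popZ !lie_moduleZ lexpZ scalerBr.
by apply/lfunP => v; rewrite [LHS](dim0_eq0 _ V_eq0) [RHS](dim0_eq0 _ V_eq0).
Qed.

End PDefect.

(** * Base change and weights *)

Section BaseChangeMaps.

Variables (F K : fieldType) (iota : {rmorphism F -> K}).

(** Extends [bc_hom] to maps between different spaces, as required for inclusions of summands and
    projections onto them. *)
Definition bc_map (V W : vectType F) (f : 'Hom(V, W)) :
    'Hom(base_change iota V, base_change iota W) :=
  linfun (mulmxr (map_mx iota (mxof (vbasis {:V}) (vbasis {:W}) f)) :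
            base_change iota V -> base_change iota W).

Lemma bc_mapE (V W : vectType F) (f : 'Hom(V, W)) v :
  bc_map f (bc_vec iota v) = bc_vec iota (f v).
Proof.
rewrite /bc_map lfunE /= /bc_vec -map_mxM; congr map_mx.
by rewrite (@rVof_app _ _ _ (vbasis {:V})) ?vbasisP.
Qed.

Lemma bc_ext (V : vectType F) (W : vectType K) (f g : 'Hom(base_change iota V, W)) :
  (forall v, f (bc_vec iota v) = g (bc_vec iota v)) -> f = g.
Proof.
move=> fg; apply/lfunP; apply: bc_ind => [|a u v fgu fgv|//].
  by rewrite !linear0.
by rewrite !linearP /= fgu fgv.
Qed.

Lemma bc_map_comp (U V W : vectType F) (f : 'Hom(V, W)) (g : 'Hom(U, V)) :
  bc_map (f \o g)%VF = (bc_map f \o bc_map g)%VF.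
Proof. by apply: bc_ext => v; rewrite !(comp_lfunE, bc_mapE). Qed.

Lemma bc_map1 (V : vectType F) : bc_map (\1%VF : 'End(V)) = \1%VF.
Proof. by apply: bc_ext => v; rewrite !(id_lfunE, bc_mapE). Qed.

Lemma bc_mapD (V W : vectType F) (f g : 'Hom(V, W)) :
  bc_map (f + g) = bc_map f + bc_map g.
Proof. by apply: bc_ext => v; rewrite !(add_lfunE, bc_mapE) bc_vecD. Qed.

Lemma bc_mapB (V W : vectType F) (f g : 'Hom(V, W)) :
  bc_map (f - g) = bc_map f - bc_map g.
Proof. by apply: bc_ext => v; rewrite !(add_lfunE, opp_lfunE, bc_mapE) bc_vecB. Qed.

Lemma bc_mapZ (V W : vectType F) a (f : 'Hom(V, W)) :
  bc_map (a *: f) = iota a *: bc_map f.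
Proof. by apply: bc_ext => v; rewrite !(scale_lfunE, bc_mapE) bc_vecZ. Qed.

Lemma bc_map0 (V W : vectType F) : bc_map (0 : 'Hom(V, W)) = 0.
Proof. by rewrite -[X in bc_map X](subrr 0) bc_mapB subrr. Qed.

Lemma bc_map_sum (V W : vectType F) (I : finType) (f : I -> 'Hom(V, W)) :
  bc_map (\sum_i f i) = \sum_i bc_map (f i).
Proof. exact: (big_morph _ (@bc_mapD V W) (bc_map0 V W)). Qed.

Lemma bc_map_lexp (V : vectType F) n (f : 'End(V)) :
  bc_map (lexp n f) = lexp n (bc_map f).
Proof.
elim: n => [|n IHn]; first exact: bc_map1.
by rewrite /lexp !iterS bc_map_comp -/(lexp n _) IHn.
Qed.

Lemma bc_vec_eq0 (V : vectType F) (v : V) :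
  bc_vec iota v = 0 -> v = 0.
Proof.
by move=> /eqP; rewrite map_mx_eq0 rVof_eq0 ?vbasisP // => /eqP.
Qed.

Section Action.

Variables (L : lieAlgType F) (V : vectType F) (rho : L -> 'End(V)).
Hypothesis Vmod : lie_module rho.

Lemma bc_action_map x :
  bc_action rho (bc_vec iota x) = bc_map (rho x) :> 'End(base_change iota V).
Proof. by apply: bc_ext => v; rewrite bc_actionE ?bc_mapE //; case: Vmod. Qed.

Lemma bc_action0 u : bc_action rho (0 : base_change iota L) u = 0.
Proof.
by have := bc_actionP rho (-1) (0 : base_change iota L) 0 u;
   rewrite scaler0 add0r scaleN1r addNr.
Qed.

Lemma bc_submoduleP (U : {vspace base_change iota V}) :
  submodule (bc_action rho : base_change iota L -> _) U <->
  forall x u, u \in U -> bc_map (rho x) u \in U.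
Proof.
split=> [/submoduleP sU x u uU|sU].
  by rewrite -bc_action_map; apply: sU.
apply/submoduleP => y u uU; move: y.
apply: bc_ind => [|a y z Uy Uz|x]; last by rewrite bc_action_map sU.
  by rewrite bc_action0 mem0v.
by rewrite bc_actionP memvD // memvZ.
Qed.

Variables (p : nat) (pop : L -> L).

Lemma bc_pdefectE x u :
  bc_map (pdefect p pop rho x) u =
  iter p (bc_action rho (bc_vec iota x)) u - bc_action rho (bc_vec iota (pop x)) u.
Proof.
rewrite !bc_action_map bc_mapB bc_map_lexp.
by rewrite add_lfunE opp_lfunE lexpE.
Qed.

Hypothesis charFp : p \in [pchar F].
Hypothesis Lp : p_operation p pop.

Local Notation sigma := (bc_action rho : base_change iota L -> 'End(base_change iota V)).

Lemma bc_pdefect_comm x y u :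
  bc_map (pdefect p pop rho x) (sigma y u) = sigma y (bc_map (pdefect p pop rho x) u).
Proof.
move: y; apply: bc_ind => [|a y z yE zE|y].
- by rewrite !bc_action0 linear0.
- by rewrite !bc_actionP linearP /= yE zE.
rewrite bc_action_map -!comp_lfunE -!bc_map_comp; congr (bc_map _ _).
by apply/lfunP => v; rewrite !comp_lfunE (pdefect_comm charFp Lp Vmod).
Qed.

Lemma bc_pdefect_stable x U :
  submodule sigma U -> (bc_map (pdefect p pop rho x) @: U <= U)%VS.
Proof.
move=> /bc_submoduleP sU; apply/subvP => _ /memv_imgP[u uU ->].
rewrite bc_mapB bc_map_lexp add_lfunE opp_lfunE memvB ?sU // lexp_stable //.
by apply/subvP => _ /memv_imgP[w wU ->]; apply: sU.
Qed.

End Action.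
End BaseChangeMaps.

Lemma iter_quot_action (K : fieldType) (L : lieAlgType K) (V : vectType K)
    (rho : L -> 'End(V)) (U W : {vspace V}) n x u :
  submodule rho U -> submodule rho W -> (W <= U)%VS -> u \in U ->
  iter n (quot_action rho U W x) (quot_proj U W u) = quot_proj U W (iter n (rho x) u).
Proof.
move=> sU sW WU uU; elim: n => //= n ->; apply: quot_actionE => //.
by rewrite -lexpE lexp_stable.
Qed.

Section Weights.

Variables (F : fieldType) (p : nat) (Fbar : fieldType) (iota : {rmorphism F -> Fbar}).
Variables (L : lieAlgType F) (pop : L -> L).
Variables (V : vectType F) (rho : L -> 'End(V)).

Local Notation sigma := (bc_action rho : base_change iota L -> 'End(base_change iota V)).

(* When e is an L-linear idempotent, these are the weights of the submodule
   limg e of V. *)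
Definition weight (e : 'End(V)) (c : L -> Fbar) : Prop :=
  exists U, [/\ submodule sigma U, U != 0%VS,
    forall u, u \in U -> bc_map iota e u = u &
    forall x u, u \in U -> bc_map iota (pdefect p pop rho x) u = c x ^+ p *: u].

Hypothesis charFp : p \in [pchar F].
Hypothesis Lp : p_operation p pop.
Hypothesis Vmod : lie_module rho.

Lemma has_charP (U W : {vspace base_change iota V}) c :
  submodule sigma U -> submodule sigma W -> (W <= U)%VS ->
  has_char p pop (quot_action sigma U W) c <->
  forall x u, u \in U ->
    bc_map iota (pdefect p pop rho x) u - c x ^+ p *: u \in W.
Proof.
move=> sU sW WU.
have NU x u : u \in U -> bc_map iota (pdefect p pop rho x) u - c x ^+ p *: u \in U.
  move=> uU; rewrite memvB ?memvZ //.
  by rewrite (subvP (bc_pdefect_stable Vmod p pop x sU)) // memv_img.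
have NE x u : u \in U ->
    quot_proj U W (bc_map iota (pdefect p pop rho x) u - c x ^+ p *: u) =
    iter p (quot_action sigma U W (bc_vec iota x)) (quot_proj U W u)
    - quot_action sigma U W (bc_vec iota (pop x)) (quot_proj U W u)
    - c x ^+ p *: quot_proj U W u.
  move=> uU; rewrite iter_quot_action // quot_actionE // -linearB -linearZ -linearB.
  by rewrite bc_pdefectE.
split=> [hc x u uU|hN x v].
  by rewrite -(quot_proj_ker W (NU _ _ uU)) NE // hc subrr.
have vU : vsval v \in U by apply: (subvP (diffvSl U W)); apply: subvsP.
apply/eqP; rewrite -subr_eq0 -[v]quot_projK -NE // quot_proj_ker ?hN //.
exact: NU.
Qed.

(** A factor U/W with character c says that all psi(x) - c(x)^p map U into W, and [eigen_submodule]
    turns this into a genuine submodule killed by them. Conversely, a minimal submodule is a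
    composition factor over 0. *)
Lemma Cl_weight c : Cl p iota pop rho c <-> is_char iota c /\ weight \1 c.
Proof.
split=> [[char_c [_ [_ [[m [S [[S0 Sm sS irrS] [i ltim [-> ->]]]]] has_c]]]]|].
  split=> //; have [sSi sSi1] := (sS i (ltnW ltim), sS i.+1 ltim).
  have [leS [nz_quot _]] := irrS i ltim.
  have nleS : ~~ (S i.+1 <= S i)%VS.
    apply/negP => leS'; apply: nz_quot; apply/eqP; rewrite -dimv_eq0 dimvf.
    by rewrite -[dim _]/(\dim _) dimv_eq0 diffv_eq0.
  have [Z [sZ _ nz_Z _] [_ TZ]] :=
    eigen_submodule (bc_pdefect_comm Vmod charFp Lp)
      (bc_pdefect_stable Vmod p pop) sSi1 sSi nleS
      ((has_charP c sSi1 sSi leS).1 has_c).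
  exists Z; split=> //; first by apply/eqP/nesym.
  by move=> u _; rewrite bc_map1 id_lfunE.
case=> char_c [U [sU nzU _ TU]]; split=> //.
have [|Z minZ ZU] := minimal_overP sU (sub0v U); first exact/nesym/eqP.
exists Z, 0%VS; split; first exact: composition_factor_minimal.
have [sZ _ _ _] := minZ.
apply/has_charP => //; first exact: submodule0.
  exact: sub0v.
by move=> x u uZ; rewrite TU ?subrr ?mem0v // (subvP ZU).
Qed.

End Weights.

(** * Idempotent endomorphisms of a Lie module *)

Section WeightTransport.

Variables (F : fieldType) (p : nat) (Fbar : fieldType) (iota : {rmorphism F -> Fbar}).
Variables (L : lieAlgType F) (pop : L -> L).

Lemma lexp_intertwine (V V' : vectType F) (h : 'Hom(V, V')) f f' n :
  (h \o f = f' \o h)%VF -> (h \o lexp n f = lexp n f' \o h)%VF.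
Proof.
move=> hf; elim: n => [|n IHn]; first by rewrite comp_lfun1r comp_lfun1l.
by rewrite /lexp !iterS -!/(lexp n _) comp_lfunA hf -comp_lfunA IHn comp_lfunA.
Qed.

Lemma pdefect_intertwine (V V' : vectType F) (rho : L -> 'End(V))
    (rho' : L -> 'End(V')) (h : 'Hom(V, V')) x :
  (forall x, h \o rho x = rho' x \o h)%VF ->
  (h \o pdefect p pop rho x = pdefect p pop rho' x \o h)%VF.
Proof.
move=> hrho; rewrite /pdefect comp_lfunDr comp_lfunDl comp_lfunNr comp_lfunNl.
by rewrite hrho (lexp_intertwine _ (hrho x)).
Qed.

Lemma weight_img (V V' : vectType F) (rho : L -> 'End(V)) (rho' : L -> 'End(V'))
    (h : 'Hom(V, V')) (e' : 'End(V')) c U :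
  lie_module rho -> lie_module rho' ->
  (forall x, h \o rho x = rho' x \o h)%VF ->
  submodule (bc_action rho : base_change iota L -> 'End(base_change iota V)) U ->
  (bc_map iota h @: U != 0)%VS ->
  (forall u, u \in U -> bc_map iota e' (bc_map iota h u) = bc_map iota h u) ->
  (forall x u, u \in U -> bc_map iota (pdefect p pop rho x) u = c x ^+ p *: u) ->
  weight p iota pop rho' e' c.
Proof.
move=> mod mod' hrho /(bc_submoduleP mod) sU nzU eU TU.
exists (bc_map iota h @: U)%VS; split=> //.
- apply/(bc_submoduleP mod') => x _ /memv_imgP[u uU ->].
  by rewrite -comp_lfunE -bc_map_comp -hrho bc_map_comp comp_lfunE memv_img // sU.
- by move=> _ /memv_imgP[u uU ->]; apply: eU.
- move=> x _ /memv_imgP[u uU ->]; rewrite -comp_lfunE -bc_map_comp.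
  by rewrite -(pdefect_intertwine _ hrho) bc_map_comp comp_lfunE TU // linearZ.
Qed.

(** The left inverse [g] of [h] on the image of [e] ensures that the image of the weight submodule
    is nonzero. *)
Lemma weight_transport (V V' : vectType F) (rho : L -> 'End(V)) (rho' : L -> 'End(V'))
    (h : 'Hom(V, V')) (g : 'Hom(V', V)) (e : 'End(V)) (e' : 'End(V')) c :
  lie_module rho -> lie_module rho' ->
  (forall x, h \o rho x = rho' x \o h)%VF ->
  (g \o h \o e = e)%VF -> (e' \o h \o e = h \o e)%VF ->
  weight p iota pop rho e c -> weight p iota pop rho' e' c.
Proof.
move=> mod mod' hrho ghe ehe [U [sU nzU eU TU]].
apply: (weight_img mod mod' hrho sU) => // [|u uU].
  apply: contra nzU => /eqP hU0; rewrite -subv0; apply/subvP => u uU.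
  have hu : bc_map iota h u = 0 by apply/eqP; rewrite -memv0 -hU0 memv_img.
  by rewrite -(eU _ uU) -ghe !bc_map_comp !comp_lfunE eU // hu linear0 mem0v.
by rewrite -{1 2}(eU _ uU) -!comp_lfunE -!bc_map_comp ehe.
Qed.

End WeightTransport.

Section LieIdempotents.

Variables (F : fieldType) (p : nat) (Fbar : fieldType) (iota : {rmorphism F -> Fbar}).
Variables (L : lieAlgType F) (pop : L -> L).
Variables (V : vectType F) (rho : L -> 'End(V)).
Hypothesis Vmod : lie_module rho.

Implicit Types e f : 'End(V).

Definition lie_endo f := forall x, (f \o rho x = rho x \o f)%VF.

Definition lie_idem e := lie_endo e /\ (e \o e)%VF = e.

Lemma lie_endoE f x v : lie_endo f -> f (rho x v) = rho x (f v).
Proof. by move=> fL; rewrite -!comp_lfunE fL. Qed.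

Lemma lie_endo_comp f g : lie_endo f -> lie_endo g -> lie_endo (f \o g)%VF.
Proof. by move=> fL gL x; rewrite -comp_lfunA gL comp_lfunA fL comp_lfunA. Qed.

Lemma lie_endoB f g : lie_endo f -> lie_endo g -> lie_endo (f - g).
Proof.
by move=> fL gL x; rewrite comp_lfunDl comp_lfunDr comp_lfunNl comp_lfunNr fL gL.
Qed.

Lemma lie_endoZ1 a : lie_endo (a *: \1%VF).
Proof. by move=> x; rewrite -comp_lfunZl -comp_lfunZr comp_lfun1l comp_lfun1r. Qed.

Lemma lie_endo1 : lie_endo \1%VF.
Proof. by move=> x; rewrite comp_lfun1l comp_lfun1r. Qed.

Lemma lie_idem0 : lie_idem 0.
Proof. by split=> [x|]; rewrite ?comp_lfun0l ?comp_lfun0r. Qed.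

Lemma lie_idem1 : lie_idem \1%VF.
Proof. by split; [apply: lie_endo1 | rewrite comp_lfun1l]. Qed.

Lemma submodule_limg f : lie_endo f -> submodule rho (limg f).
Proof.
by move=> fL; apply: submodule_img (submodulef rho) => x u _; apply: lie_endoE.
Qed.

Lemma limg_idemP e u : lie_idem e -> reflect (e u = u) (u \in limg e).
Proof.
case=> _ ee; apply: (iffP memv_imgP) => [[v _ ->]|<-]; last first.
  by exists u; rewrite ?memvf.
by rewrite -comp_lfunE ee.
Qed.

(** Transport along the inclusion [i] and the projection [q]. This lets the cluster of a summand be
    computed inside [V]. *)
Lemma weight_limg e c : lie_idem e ->
  weight p iota pop (sub_action rho (limg e)) \1%VF c <-> weight p iota pop rho e c.
Proof.
move=> idem_e; have [eL ee] := idem_e; have sU := submodule_limg eL.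
have mod' := lie_module_sub Vmod sU.
pose i : 'Hom(subvs_of (limg e), V) := linfun vsval.
pose q : 'Hom(V, subvs_of (limg e)) := (linfun (vsproj (limg e)) \o e)%VF.
have iE u : i u = vsval u by rewrite lfunE.
have iq : (i \o q = e)%VF.
  by apply/lfunP => v; rewrite !comp_lfunE !lfunE /= vsprojK // memv_img ?memvf.
have qi : (q \o i = \1)%VF.
  apply/lfunP => u; rewrite !comp_lfunE !lfunE /=.
  by rewrite (limg_idemP _ idem_e _) ?subvsP // vsvalK.
have irho x : (i \o sub_action rho (limg e) x = rho x \o i)%VF.
  by apply/lfunP => u; rewrite [LHS]comp_lfunE [RHS]comp_lfunE !iE sub_actionE.
have qrho x : (q \o rho x = sub_action rho (limg e) x \o q)%VF.
  have iqE v : vsval (q v) = e v by have /lfunP/(_ v) := iq; rewrite comp_lfunE iE.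
  apply/lfunP => u; apply: subvs_inj; rewrite [X in vsval X]comp_lfunE iqE.
  by rewrite [X in _ = vsval X]comp_lfunE sub_actionE // iqE lie_endoE.
split.
  apply: (weight_transport (g := q) mod' Vmod irho).
    by rewrite qi comp_lfun1l.
  rewrite !comp_lfun1r; apply/lfunP => u; rewrite comp_lfunE iE.
  by apply/(limg_idemP _ idem_e)/subvsP.
apply: (weight_transport (g := i) Vmod mod' qrho).
  by rewrite iq ee.
by rewrite comp_lfun1l.
Qed.

(** Some [es i] does not kill the weight submodule of [e], and its image under that [es i] is again
    a weight submodule for [c]. *)
Lemma weight_sum (I : finType) (es : I -> 'End(V)) e c :
  (forall i, lie_idem (es i)) -> \sum_i es i = e ->
  weight p iota pop rho e c -> exists i, weight p iota pop rho (es i) c.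
Proof.
move=> idem <- [U [sU nzU eU TU]].
have [i nz_i] : exists i, (bc_map iota (es i) @: U)%VS != 0%VS.
  apply: contrapT => /forallNP z; move/negP: nzU; apply.
  rewrite -subv0; apply/subvP => u uU; rewrite -(eU u uU) bc_map_sum sum_lfunE.
  rewrite big1 ?mem0v // => i _; apply/eqP; rewrite -memv0.
  by have /negP/negPn/eqP <- := z i; apply: memv_img.
exists i; have [iL ii] := idem i; apply: (weight_img Vmod Vmod iL sU nz_i) => // u uU.
by rewrite -comp_lfunE -bc_map_comp ii.
Qed.

Lemma weight_sub1 e c : weight p iota pop rho e c -> weight p iota pop rho \1%VF c.
Proof.
apply: (@weight_transport _ _ _ _ _ _ _ _ _ _ \1%VF \1%VF) => //.
- exact: lie_endo1.
- by rewrite !comp_lfun1l.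
- by rewrite !comp_lfun1l.
Qed.

Definition indecomposable e := forall a b, lie_idem a -> lie_idem b ->
  a + b = e -> (a \o b = 0)%VF -> (b \o a = 0)%VF -> a = 0 \/ b = 0.

(** The Fitting projection [q] of [f] is an L-linear idempotent below [e], so q + (e - q) = e forces
    q = 0 (a power of [f] vanishes) or q = e (that power is invertible on the image of [e]). *)
Lemma indecomposable_fitting e f : lie_idem e -> indecomposable e ->
  lie_endo f -> (f \o e = f)%VF -> (e \o f = f)%VF ->
  exists2 n, (0 < n)%N & lexp n f = 0 \/ exists h, e = (h \o lexp n f)%VF.
Proof.
move=> [eL ee] indec fL fe ef.
have [n [n_gt0 sumAB dxAB]] := fitting (subvf (f @: fullv)).
exists n => //; set g := lexp n f in sumAB dxAB *; rewrite capfv in sumAB.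
have gL : lie_endo g by move=> x; apply/esym/lexp_intertwine/esym/fL.
have [ge eg] : (g \o e = g)%VF /\ (e \o g = g)%VF.
  rewrite /g; case: n n_gt0 {sumAB dxAB g gL} => // n _.
  split; last by rewrite /lexp iterS comp_lfunA ef.
  apply/lfunP => v; rewrite comp_lfunE !lexpE !iterSr.
  by rewrite -[f (e v)]comp_lfunE fe.
pose q := daddv_pi (limg g) (lker g).
have qA u : u \in limg g -> q u = u by apply: daddv_pi_id.
have qB u : u \in lker g -> q u = 0.
  move=> uB; have uBA : u \in (limg g + lker g)%VS by rewrite (subvP (addvSr _ _)).
  have := daddv_pi_add dxAB uBA; rewrite [X in _ + X]daddv_pi_id //; last first.
    by rewrite capvC.
  by move=> quE; apply: (addIr u); rewrite add0r.
have qin u : q u \in limg g by apply: memv_pi.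
have qE u : q (u - q u) = 0 by rewrite linearB /= [q (q u)]qA ?subrr.
have decomp u : exists2 b, b \in lker g & exists2 a, a \in limg g & u = b + a.
  by have /memv_addP := subvP sumAB u (memvf u).
have qL : lie_endo q.
  move=> x; apply/lfunP => u; have [b bB [a aA ->]] := decomp u.
  rewrite !comp_lfunE !linearD /= (qB b) // (qA a) //.
  rewrite qB ?qA ?linear0 //; first by apply/(submoduleP _ _).1: aA; apply: submodule_limg.
  rewrite memv_ker (lie_endoE _ _ gL).
  by rewrite (eqP (_ : g b == 0)) ?linear0 -?memv_ker.
have qq : (q \o q = q)%VF by apply/lfunP => u; rewrite comp_lfunE qA.
have qe : (q \o e = q)%VF.
  apply/lfunP => u; apply/esym/eqP; rewrite comp_lfunE -subr_eq0 -linearB /= qB //.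
  by rewrite memv_ker linearB /= -[g (e u)]comp_lfunE ge subrr.
have eq : (e \o q = q)%VF.
  apply/lfunP => u; rewrite comp_lfunE; have /memv_imgP[w _ ->] := qin u.
  by rewrite -comp_lfunE eg.
have [|||||q0|eq0] := indec q (e - q).
- by split.
- split; first exact: lie_endoB.
  by rewrite comp_lfunDl !comp_lfunDr !(comp_lfunNl, comp_lfunNr) ee eq qe qq
             subrr addr0.
- by rewrite addrC subrK.
- by rewrite comp_lfunDr comp_lfunNr qe qq subrr.
- by rewrite comp_lfunDl comp_lfunNl eq qq subrr.
- left; apply/lfunP => u; rewrite zero_lfunE.
  by rewrite -[g u]qA ?memv_img ?memvf // q0 zero_lfunE.
(* [g^-1] inverts [g] only on its image: u - g^-1 (g u) lies in the kernel of [g], which [q = e]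
   annihilates. *)
- right; exists (e \o g^-1)%VF; apply/lfunP => u; rewrite !comp_lfunE.
  have eq' : e = q by apply/eqP; rewrite -subr_eq0 eq0.
  apply/eqP; rewrite -subr_eq0 -linearB /= eq' qB //.
  by rewrite memv_ker linearB /= limg_lfunVK ?subrr // memv_img ?memvf.
Qed.

End LieIdempotents.

(** * Weights of an indecomposable summand *)

Lemma pchar_expr_inj (K : fieldType) (p : nat) :
  p \in [pchar K] -> injective (fun a : K => a ^+ p).
Proof.
move=> charKp a b /= ab; apply: (fmorph_inj (pFrobenius_aut charKp)).
by rewrite /= !pFrobenius_autE.
Qed.

Lemma nonzero_vec (K : fieldType) (W : vectType K) (U : {vspace W}) :
  U != 0%VS -> exists2 u, u \in U & u != 0.
Proof. by move=> nzU; exists (vpick U); rewrite ?memv_pick ?vpick0. Qed.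

Section IndecomposableWeights.

Variables (F : fieldType) (p : nat).
Hypothesis charFp : p \in [pchar F].
Variables (Fbar : closedFieldType) (iota : {rmorphism F -> Fbar}).
Variables (L : lieAlgType F) (pop : L -> L).
Hypothesis Lp : p_operation p pop.
Variables (V : vectType F) (rho : L -> 'End(V)).
Hypothesis Vmod : lie_module rho.

Let charFbarp : p \in [pchar Fbar] := rmorph_pchar iota charFp.

Lemma exists_weight (e : 'End(V)) : lie_idem rho e -> e <> 0 ->
  exists2 c, is_char iota c & weight p iota pop rho e c.
Proof.
move=> [eL ee] nz_e.
pose sigma : base_change iota L -> 'End(base_change iota V) := bc_action rho.
pose U := limg (bc_map iota e).
have sU : submodule sigma U.
  apply/(bc_submoduleP Vmod) => x _ /memv_imgP[u _ ->].
  by rewrite -comp_lfunE -bc_map_comp -eL bc_map_comp comp_lfunE memv_img ?memvf.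
have nzU : 0%VS <> U.
  move=> U0; apply: nz_e; apply/lfunP => v; rewrite zero_lfunE.
  apply: (@bc_vec_eq0 _ _ iota); apply/eqP.
  by rewrite -bc_mapE -memv0 U0 memv_img ?memvf.
have [Z minZ ZU] := minimal_overP sU (sub0v U) nzU.
have [sZ _ nzZ irrZ] := minZ; have {}nzZ : Z != 0%VS by apply/eqP/nesym.
have [c cE] : {c : L -> Fbar & forall x u, u \in Z ->
    bc_map iota (pdefect p pop rho x) u = c x ^+ p *: u}.
  apply: (@choice _ _ (fun x a => forall u, u \in Z -> _ = a ^+ p *: u)) => x.
  have [a [u [uZ nz_u] ua]] :=
    closed_eigenvector (bc_pdefect_stable Vmod p pop x sZ) nzZ.
  have [b ba] : exists b : Fbar, b ^+ p = a.
    have /closed_rootP[b] : size ('X^p - a%:P : {poly Fbar}) != 1%N.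
      by rewrite size_XnsubC ?prime_gt0 ?(pcharf_prime charFp) // eqSS -lt0n
                 prime_gt0 ?(pcharf_prime charFp).
    by rewrite rootE !hornerE subr_eq0 => /eqP; exists b.
  exists b; rewrite ba; set T := bc_map _ _ in ua *.
  pose N := T - a *: \1%VF.
  have NE w : N w = T w - a *: w.
    by rewrite !(add_lfunE, opp_lfunE, scale_lfunE, id_lfunE).
  have sN : submodule sigma (Z :&: lker N).
    apply: submodule_cap => //; apply: submodule_ker => y w.
    by rewrite !NE (bc_pdefect_comm Vmod charFp Lp) [in RHS]linearB [in RHS]linearZ.
  (* Schur's argument: the eigenspace in the minimal submodule [Z] is a submodule and contains the
     nonzero [u], so it is all of [Z]. *)
  have [N0|<-] := irrZ _ sN (sub0v _) (capvSl _ _); last first.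
    move=> w; rewrite memv_cap => /andP[_]; rewrite memv_ker NE subr_eq0.
    by move/eqP.
  move: nz_u; rewrite -memv0 -N0 memv_cap uZ memv_ker NE ua subrr.
  by rewrite eqxx.
exists c; last first.
  exists Z; split=> // u /(subvP ZU) /memv_imgP[w _ ->].
  by rewrite -comp_lfunE -bc_map_comp ee.
(* The values of [c] were chosen one [x] at a time. Uniqueness of p-th roots nevertheless makes [c]
   linear, because psi is p-semilinear. *)
move=> a x y; apply: (pchar_expr_inj charFbarp) => /=.
have [u uZ nz_u] := nonzero_vec nzZ.
apply/eqP; rewrite -subr_eq0.
suff /eqP : (c (a *: x + y) ^+ p - (iota a * c x + c y) ^+ p) *: u = 0.
  by rewrite scaler_eq0 (negPf nz_u) orbF.
rewrite scalerBl -cE // (pdefect_semilinear charFp Lp Vmod) bc_mapD bc_mapZ.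
rewrite add_lfunE scale_lfunE !cE // scalerA -scalerDl -scalerBl.
rewrite -[(_ + c y) ^+ p](pFrobenius_autE charFbarp) rmorphD rmorphM /=.
by rewrite !pFrobenius_autE rmorphXn subrr scale0r.
Qed.

Hypothesis Fbar_alg : forall z : Fbar, algebraicOver iota z.

Lemma indecomposable_weights (e : 'End(V)) c d :
  lie_idem rho e -> indecomposable rho e ->
  weight p iota pop rho e c -> weight p iota pop rho e d -> conj_class iota c d.
Proof.
move=> idem_e indec [U [_ nzU eU TU]] [U' [_ nzU' eU' TU']].
have [v vU nzv] := nonzero_vec nzU; have [v' v'U nzv'] := nonzero_vec nzU'.
have [eL ee] := idem_e.
pose G : set (Fbar * Fbar) := [set u | exists2 S : 'End(V), lie_endo rho S &
  bc_map iota S v = u.1 *: v /\ bc_map iota S v' = u.2 *: v']%classic.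
have homG : hom_graph iota G.
  split.
  - move=> a; exists (a *: \1%VF); first exact: lie_endoZ1.
    by rewrite bc_mapZ bc_map1 !scale_lfunE !id_lfunE.
  - move=> u w [S SL [Sv Sv']] [S' S'L [S'v S'v']]; exists (S - S').
      exact: lie_endoB.
    by rewrite bc_mapB !add_lfunE !opp_lfunE Sv Sv' S'v S'v' !scalerBl.
  - move=> u w [S SL [Sv Sv']] [S' S'L [S'v S'v']]; exists (S \o S')%VF.
      exact: lie_endo_comp.
    rewrite bc_map_comp !comp_lfunE S'v S'v' !linearZ /= Sv Sv' !scalerA.
    by rewrite [w.1 * _]mulrC [w.2 * _]mulrC.
  (* The compression [f] of [S] kills [v] and has eigenvalue [b] at [v']. An invertible power would
     give v = 0, so [f] is nilpotent and a power of [b] vanishes. *)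
  move=> b [S SL [/= Sv Sv']]; pose f := (e \o S \o e)%VF.
  have fL : lie_endo rho f by do 2!apply: lie_endo_comp => //.
  have fv : bc_map iota f v = 0.
    by rewrite !bc_map_comp !comp_lfunE (eU v vU) Sv scale0r linear0.
  have fv' : bc_map iota f v' = b *: v'.
    by rewrite !bc_map_comp !comp_lfunE (eU' v' v'U) Sv' linearZ /= eU'.
  have fv'n n : bc_map iota (lexp n f) v' = b ^+ n *: v'.
    rewrite bc_map_lexp lexpE; elim: n => [|n IHn]; first by rewrite scale1r.
    by rewrite iterS IHn linearZ /= fv' scalerA exprSr.
  have [||n n_gt0 [fn0|[h eE]]] := indecomposable_fitting idem_e indec fL.
  - by rewrite /f -comp_lfunA ee.
  - by rewrite /f !comp_lfunA ee.
  - move: (fv'n n); rewrite fn0 bc_map0 zero_lfunE => /esym/eqP.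
    by rewrite scaler_eq0 (negPf nzv') orbF expf_eq0 n_gt0 => /eqP.
  case/eqP: nzv; rewrite -(eU v vU) eE bc_map_comp comp_lfunE bc_map_lexp lexpE.
  case: n n_gt0 {eE} => // n _; rewrite iterSr fv -lexpE linear0.
  by rewrite linear0.
have [alpha autA alphaG] := extend_to_Aut Fbar_alg homG.
exists alpha => //; apply/funext => x; apply: (pchar_expr_inj charFbarp).
rewrite /= -rmorphXn.
apply/esym/alphaG; exists (pdefect p pop rho x); last by rewrite /= TU ?TU'.
move=> y; apply/lfunP => w; rewrite !comp_lfunE.
exact: pdefect_comm.
Qed.

End IndecomposableWeights.

(** * Grouping indecomposable summands *)

Local Open Scope classical_set_scope.

Section Conjugacy.

Variables (F Fbar : fieldType) (iota : {rmorphism F -> Fbar}) (L : lieAlgType F).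
Implicit Types c d : L -> Fbar.

Lemma conj_class_sym c d : conj_class iota c d -> conj_class iota d c.
Proof.
move=> [alpha [[g alphaK gK] alphaF] ->].
have gB : zmod_morphism g.
  by move=> x y; apply: (can_inj alphaK); rewrite rmorphB !gK.
have gM : monoid_morphism g.
  by split=> [|x y]; apply: (can_inj alphaK); rewrite ?rmorph1 ?rmorphM !gK.
pose beta := HB.pack_for {rmorphism Fbar -> Fbar} g
  (GRing.isZmodMorphism.Build Fbar Fbar g gB)
  (GRing.isMonoidMorphism.Build Fbar Fbar g gM).
exists beta; last by apply/funext => x; rewrite /= alphaK.
split; first by exists alpha.
by move=> a /=; rewrite -[in LHS]alphaF alphaK.
Qed.

Lemma simple_cluster_sub (C D : set (L -> Fbar)) c :
  simple_cluster iota C -> simple_cluster iota D -> C c -> D c -> C `<=` D.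
Proof.
move=> [_ [c0 _ ->]] [[_ _ Dconj] _] c0c Dc.
exact: (Dconj c0) (Dconj c Dc _ (conj_class_sym c0c)).
Qed.

Lemma simple_cluster_eq (C D : set (L -> Fbar)) c :
  simple_cluster iota C -> simple_cluster iota D -> C c -> D c -> C = D.
Proof.
move=> sC sD Cc Dc; apply/seteqP.
by split; [apply: simple_cluster_sub Cc Dc | apply: simple_cluster_sub Dc Cc].
Qed.

End Conjugacy.

(** * Splitting an idempotent into orthogonal idempotents *)

Section IdempotentDecomposition.

Variables (K : fieldType) (L : lieAlgType K) (V : vectType K) (rho : L -> 'End(V)).
Implicit Types (a b e : 'End(V)).

Lemma orth_idem_dim a b : (a \o a = a)%VF -> (b \o b = b)%VF ->
  (a \o b = 0)%VF -> (b \o a = 0)%VF -> b <> 0 ->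
  (\dim (limg a) < \dim (limg (a + b)%R))%N.
Proof.
move=> aa bb ab ba nz_b.
have sub : (limg a <= limg (a + b)%R)%VS.
  apply/subvP => _ /memv_imgP[u _ ->].
  have -> : a u = (a + b) (a u).
    by rewrite add_lfunE -!comp_lfunE aa ba zero_lfunE addr0.
  by rewrite memv_img ?memvf.
rewrite ltn_neqAle dimvS // andbT (dimv_leqif_eq sub).
apply/eqP => aE; apply: nz_b; apply/lfunP => u; rewrite zero_lfunE.
have : b u \in limg a.
  rewrite aE; have -> : b u = (a + b) (b u).
    by rewrite add_lfunE -!comp_lfunE bb ab zero_lfunE add0r.
  by rewrite memv_img ?memvf.
case/memv_imgP => w _ bu; have -> : b u = b (b u) by rewrite -comp_lfunE bb.
by rewrite bu -comp_lfunE ba zero_lfunE.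
Qed.

(** Splitting and grouping happen in one induction on the rank: an indecomposable goes straight into
    a slot [i] with [P i], and the slots of two orthogonal halves are added. No list of
    indecomposable summands has to be formed; a slot may stay 0. *)
Lemma idem_decomposition k (P : 'I_k -> 'End(V) -> Prop) e :
  (forall i, P i 0) ->
  (forall i a b, lie_idem rho a -> lie_idem rho b -> lie_idem rho (a + b) ->
     P i a -> P i b -> P i (a + b)) ->
  (forall a, lie_idem rho a -> indecomposable rho a -> a <> 0 -> exists i, P i a) ->
  lie_idem rho e ->
  exists es : 'I_k -> 'End(V), [/\ forall i, lie_idem rho (es i), \sum_i es i = e,
    forall i j, i != j -> (es i \o es j = 0)%VF & forall i, P i (es i)].
Proof.
move=> P0 PD P_indec.
have [n] := ubnP (\dim (limg e)); elim: n e => // n IHn e dim_e idem_e.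
have [->|nz_e] := pselect (e = 0).
  exists (fun=> 0); split=> // [_||_ _ _]; first exact: lie_idem0.
    by rewrite big1.
  by rewrite /= comp_lfun0l.
have [indec_e|] := pselect (indecomposable rho e).
  have [i Pi] := P_indec e idem_e indec_e nz_e.
  exists (fun j => if j == i then e else 0); split=> [j||j l|j].
  - by case: eqP => // _; apply: lie_idem0.
  - by rewrite -big_mkcond big_pred1_eq.
  - case: (eqVneq j i) => [->|_]; last by rewrite comp_lfun0l.
    by rewrite eq_sym => /negPf->; rewrite comp_lfun0r.
  - by case: eqP => [->|].
rewrite /indecomposable => /existsNP[a /existsNP[b]].
move=> /not_implyP[ia /not_implyP[ib /not_implyP[abE /not_implyP[ab /not_implyP[ba]]]]].
move=> /not_orP[nza nzb]; have [[_ aa] [_ bb]] := (ia, ib).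
have [||as_ [ias asE orth_as Pas]] := IHn a => //.
  by rewrite (leq_trans _ (dim_e : (_ <= n)%N)) // -abE orth_idem_dim.
have [||bs [ibs bsE orth_bs Pbs]] := IHn b => //.
  by rewrite (leq_trans _ (dim_e : (_ <= n)%N)) // -abE addrC orth_idem_dim.
have suml (fs : 'I_k -> 'End(V)) f i : (forall i, lie_idem rho (fs i)) ->
    \sum_i fs i = f -> (forall i j, i != j -> (fs i \o fs j = 0)%VF) ->
    (fs i \o f = fs i)%VF /\ (f \o fs i = fs i)%VF.
  move=> ifs <- orth; split; apply/lfunP => v; rewrite comp_lfunE sum_lfunE.
    rewrite linear_sum (bigD1 i) //= -comp_lfunE (ifs i).2 big1 ?addr0 // => j ji.
    by rewrite -comp_lfunE orth ?zero_lfunE // eq_sym.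
  rewrite (bigD1 i) //= -comp_lfunE (ifs i).2 big1 ?addr0 // => j ji.
  by rewrite -comp_lfunE orth ?zero_lfunE.
(* [as_ i] absorbs [a] on the right and [bs j] absorbs [b] on the left, so the product contains the
   factor a b = 0. *)
have as_bs i j : (as_ i \o bs j = 0)%VF.
  rewrite -(suml _ _ i ias asE orth_as).1 -(suml _ _ j ibs bsE orth_bs).2.
  by rewrite comp_lfunA -[(_ \o b)%VF]comp_lfunA ab comp_lfun0r comp_lfun0l.
have bs_as i j : (bs i \o as_ j = 0)%VF.
  rewrite -(suml _ _ i ibs bsE orth_bs).1 -(suml _ _ j ias asE orth_as).2.
  by rewrite comp_lfunA -[(_ \o a)%VF]comp_lfunA ba comp_lfun0r comp_lfun0l.
have comp i j : ((as_ i + bs i) \o (as_ j + bs j) =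
    (as_ i \o as_ j) + (bs i \o bs j))%VF.
  by rewrite comp_lfunDl !comp_lfunDr as_bs bs_as addr0 add0r.
have ies i : lie_idem rho (as_ i + bs i).
  split; last by rewrite comp (ias i).2 (ibs i).2.
  by move=> x; rewrite comp_lfunDl comp_lfunDr (ias i).1 (ibs i).1.
exists (fun i => as_ i + bs i); split=> // [|i j ij|i].
- by rewrite big_split /= asE bsE.
- by rewrite comp orth_as // orth_bs // addr0.
- exact: PD.
Qed.

Lemma idem_directv k (es : 'I_k -> 'End(V)) :
  (forall i, lie_idem rho (es i)) -> \sum_i es i = \1%VF ->
  (forall i j, i != j -> (es i \o es j = 0)%VF) ->
  (\sum_i limg (es i))%VS = fullv /\ directv (\sum_i limg (es i)).
Proof.
move=> ies es1 orth; split.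
  apply/eqP; rewrite eqEsubv subvf /=; apply/subvP => v _.
  rewrite -[v]id_lfunE -es1 sum_lfunE; apply: memv_sumr => i _.
  by rewrite memv_img ?memvf.
apply/directv_sum_independent => us usP us0 i _.
have esu j : es i (us j) = if j == i then us i else 0.
  case: eqP => [->|/eqP ji]; first exact/(limg_idemP _ (ies i))/usP.
  have /memv_imgP[w _ ->] := usP j isT; rewrite -comp_lfunE.
  by rewrite orth ?zero_lfunE // eq_sym.
have := congr1 (es i) us0; rewrite linear0 linear_sum.
by rewrite (eq_bigr _ (fun j _ => esu j)) -big_mkcond big_pred1_eq.
Qed.

End IdempotentDecomposition.

Theorem theorem4p1 (F : fieldType) (p : nat) (charFp : p \in [pchar F])
  (Fbar : closedFieldType) (iota : {rmorphism F -> Fbar})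
  (Fbar_alg : forall z : Fbar, algebraicOver iota z)
  (L : lieAlgType F) (pop : L -> L) (Lp : p_operation p pop)
  (V : vectType F) (rho : L -> 'End(V)) (Vmod : lie_module rho)
  (k : nat) (C : 'I_k -> set (L -> Fbar))
  (C_simple : forall i, simple_cluster iota (C i))
  (C_distinct : injective C)
  (ClV : Cl p iota pop rho = \bigcup_(i in [set: 'I_k]) C i) :
  exists Vs : 'I_k -> {vspace V},
    [/\ forall i, submodule rho (Vs i),
        (\sum_i Vs i)%VS = fullv,
        directv (\sum_i Vs i) &
        forall i, Cl p iota pop (sub_action rho (Vs i)) = C i].
Proof.
have ClE c : Cl p iota pop rho c <-> is_char iota c /\ weight p iota pop rho \1 c.
  exact: Cl_weight.
(* Only the inclusion in [C i] is asked for: it holds vacuously for 0 and is stable under sums.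
   Equality is recovered afterwards from the cluster of [V]. *)
pose P i e := forall c, is_char iota c -> weight p iota pop rho e c -> C i c.
have [|||es [ies es1 orth esP]] :=
  @idem_decomposition _ _ _ rho k P \1%VF _ _ _ (lie_idem1 rho).
- move=> i c _ [U [_ nzU eU _]]; have [u uU nzu] := nonzero_vec nzU.
  by case/eqP: nzu; rewrite -(eU u uU) bc_map0 zero_lfunE.
- move=> i a b ia ib iab Pa Pb c char_c wc.
  pose ab (j : bool) := if j then a else b.
  have iabs j : lie_idem rho (ab j) by case: j.
  have abE : \sum_j ab j = a + b by rewrite big_bool.
  by have [[] wj] := weight_sum Vmod iabs abE wc; [apply: Pa | apply: Pb].
- move=> e ie indec nze.
  have [c char_c wc] := exists_weight charFp iota Lp Vmod ie nze.
  have : Cl p iota pop rho c by apply/ClE; split=> //; apply: weight_sub1 wc.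
  rewrite ClV => -[i _ Cic]; exists i => d _ wd.
  have [[_ _ conjC] _] := C_simple i.
  exact: conjC Cic _ (indecomposable_weights charFp Lp Vmod Fbar_alg ie indec wc wd).
have [sumV dirV] := idem_directv ies es1 orth.
exists (fun i => limg (es i)); split=> // i; first exact: submodule_limg (ies i).1.
have mod_i := lie_module_sub Vmod (submodule_limg (ies i).1).
have Cl_i c : Cl p iota pop (sub_action rho (limg (es i))) c <->
    is_char iota c /\ weight p iota pop rho (es i) c.
  by rewrite (propext (Cl_weight iota charFp Lp mod_i c))
             (propext (weight_limg p iota pop Vmod c (ies i))).
apply/seteqP; split=> c; first by move=> /Cl_i[char_c wc]; apply: esP.
move=> Cic; apply/Cl_i.
have /ClE[char_c wc] : Cl p iota pop rho c by rewrite ClV; exists i.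
(* The weight [c] of [V] must occur in some summand [j], whose weights lie in [C j]. Simple clusters
   that meet are equal, and the [C i] are distinct, so j = i. *)
split=> //; have [j wj] := weight_sum Vmod ies es1 wc.
have Cjc : C j c by apply: esP.
by rewrite (C_distinct _ _ (simple_cluster_eq (C_simple i) (C_simple j) Cic Cjc)).
Qed.
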